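(* Let $\Phi,\Psi$ be join doctrines with $\omega\in\Phi$ and $\Phi$ a sound join doctrine dual to $\Psi^{\mathrm{op}}$. Then the functors $X\mapsto \Phi\mathbf{CtsLat}(X,\mathbb{I})$ and $A\mapsto \mathbb{U}\Psi^{\mathrm{op}}\mathbf{Inf}(A,\mathbb{I})$ (acting on morphisms by precomposition) form a dual equivalence of categories between the category $\Phi\mathbf{CtsLat}$ of $\Phi$-continuous lattices and the full subcategory of $\mathbb{U}\Psi^{\mathrm{op}}\mathbf{Inf}$ on complete stackable $\mathbb{U}$-$\Psi^{\mathrm{op}}$-inflattices.
   Context: Join doctrines: a class $\Phi$ of posets such that (1) the one-element poset is in $\Phi$; (2) if a poset $P$ is the union of a set $\mathcal{S}$ of subposets each in $\Phi$ with $\mathcal{S}$ (ordered by inclusion) in $\Phi$, then $P\in\Phi$; (3) if $f:P\to Q$ is monotone with cofinal image and $P\in\Phi$ then $Q\in\Phi$; (4) cofinal subposets of members of $\Phi$ are in $\Phi$. For a poset $X$, $\mathcal{L}(X)$ = lower subsets ordered by inclusion; $\Phi(X)$ = lower subsets belonging (as subposets) to $\Phi$. A $\Phi$-join is a join of a subset $S$ with $S\in\Phi$; a $\Psi^{\mathrm{op}}$-meet is a meet of a subset $S$ with $S^{\mathrm{op}}\in\Psi$. $\omega$ = natural numbers with usual order. Soundness: $\Phi$ is sound dual to $\Psi^{\mathrm{op}}$ if (a) for all posets $X,Y$, $\phi\in\Phi(Y)$, $\psi\in\Psi(X)$, monotone $F:X^{\mathrm{op}}\times Y\to 2$: $\bigwedge_{x\in\psi}\bigvee_{y\in\phi}F=\bigvee_{y\in\phi}\bigwedge_{x\in\psi}F$,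 and (b) for every poset $X$, $\mathcal{L}(X)$ is the smallest subset of $\mathcal{L}(X)$ containing $\Psi(X)$ closed under unions of subfamilies lying (ordered by inclusion) in $\Phi$. For a complete lattice $X$ and $x\in X$ let $\Downarrow x:=\bigcap\{\phi\in\Phi(X)\mid x\le\bigvee\phi\}$, and $y\ll x$ iff $y\in\Downarrow x$. $X$ is a $\Phi$-continuous lattice if for each $x$ there is $\phi\in\Phi(X)$ with $\phi\subseteq\Downarrow x$ and $x\le\bigvee\phi$. Morphisms of $\Phi\mathbf{CtsLat}$ preserve arbitrary meets and $\Phi$-joins. $\mathbb{I}=[0,1]$; $\mathbb{U}$ = monoid of surjective monotone maps $\mathbb{I}\to\mathbb{I}$, ordered pointwise. A $\mathbb{U}$-poset is a poset with a $\mathbb{U}$-action monotone in both variables; a $\mathbb{U}$-$\Psi^{\mathrm{op}}$-inflattice is a $\mathbb{U}$-poset having all $\Psi^{\mathrm{op}}$-meets, each $u$ acting by a $\Psi^{\mathrm{op}}$-meet-preserving map; $\mathbb{U}\Psi^{\mathrm{op}}\mathbf{Inf}$ has as morphisms equivariant monotone $\Psi^{\mathrm{op}}$-meet-preserving maps. With $\dotplus$ truncated addition on $\mathbb{I}$: $a\le_r b$ iff for all $u,v\in\mathbb{U}$ with $u(t\dotplus r)\le v(t)$ for all $t$, $u(a)\le v(b)$; $\rho(a,b)=\bigwedge\{r\mid a\le_r b\}$; $\mathrm{dist}(a,b)=\rho(a,b)\vee\rho(b,a)$. Archimedean: ($a\le_r b$ for all $r>0$) $\Rightarrow a\le b$;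 complete: Archimedean and $\mathrm{dist}$-complete. Unstackable: for $0<r<1$ and $u,v\in\mathbb{U}$ restricting to order-isomorphisms $u:[0,r]\cong[0,1]$, $v:[r,1]\cong[0,1]$, $u(a)\le u(b)$ and $v(a)\le v(b)$ imply $a\le b$; stackable: unstackable and for such $r,u,v$ and $a,b$ with $v'(b)\le u'(a)$ for all $u',v'\in\mathbb{U}$ there is $c$ with $u(c)=a$, $v(c)=b$. Hom-sets into $\mathbb{I}$ carry pointwise order, pointwise meets and pointwise $\mathbb{U}$-action. *)

(* Defs.v *)
From Stdlib Require Import Reals Lra Classical ProofIrrelevance
  FunctionalExtensionality PropExtensionality.
Open Scope R_scope.

Record Poset := {
  car :> Type;
  ple : car -> car -> Prop;
  ple_refl : forall x, ple x x;
  ple_trans : forall x y z, ple x y -> ple y z -> ple x z;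
  ple_anti : forall x y, ple x y -> ple y x -> x = y }.
Arguments ple {p} _ _.

Definition sub (P : Poset) (S : P -> Prop) : Poset.
Proof.
  refine {| car := {x : P | S x};
            ple := fun a b => ple (proj1_sig a) (proj1_sig b) |}.
  - intros; apply ple_refl.
  - intros x y z; apply ple_trans.
  - intros [x hx] [y hy] h1 h2; simpl in *.
    pose proof (ple_anti _ _ _ h1 h2); subst; f_equal; apply proof_irrelevance.
Defined.

Definition op (P : Poset) : Poset.
Proof.
  refine {| car := car P; ple := fun a b => ple b a |}.
  - intros; apply ple_refl.
  - intros x y z h1 h2; exact (ple_trans _ _ _ _ h2 h1).
  - intros x y h1 h2; exact (ple_anti _ _ _ h2 h1).
Defined.

Definition prodP (P Q : Poset) : Poset.
Proof.
  refine {| car := (car P * car Q)%type;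
            ple := fun a b => ple (fst a) (fst b) /\ ple (snd a) (snd b) |}.
  - intros; split; apply ple_refl.
  - intros x y z [h1 h2] [h3 h4]; split; eapply ple_trans; eauto.
  - intros [x1 x2] [y1 y2] [h1 h2] [h3 h4]; simpl in *.
    f_equal; apply ple_anti; auto.
Defined.

Definition powerset (P : Poset) : Poset.
Proof.
  refine {| car := car P -> Prop;
            ple := fun A B => forall x, A x -> B x |}.
  - auto.
  - auto.
  - intros A B h1 h2; apply functional_extensionality; intros x;
      apply propositional_extensionality; split; auto.
Defined.

Definition funposet (X : Type) (Y : Poset) : Poset.
Proof.
  refine {| car := X -> car Y; ple := fun f g => forall x, ple (f x) (g x) |}.
  - intros; apply ple_refl.
  - intros f g h h1 h2 x; eapply ple_trans; eauto.
  - intros f g h1 h2; apply functional_extensionality; intros x;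
      apply ple_anti; auto.
Defined.

Definition unitP : Poset.
Proof.
  refine {| car := unit; ple := fun _ _ => True |}; auto.
  intros [] [] _ _; reflexivity.
Defined.

Definition natP : Poset.
Proof.
  refine {| car := nat; ple := fun m n => (m <= n)%nat |}.
  - auto.
  - intros; eapply Nat.le_trans; eauto.
  - intros; apply Nat.le_antisymm; auto.
Defined.

Definition boolP : Poset.
Proof.
  refine {| car := bool; ple := fun a b => a = true -> b = true |}.
  - auto.
  - auto.
  - intros [] [] h1 h2; auto; symmetry; auto.
Defined.

Definition Rposet : Poset.
Proof.
  refine {| car := R; ple := Rle |}.
  - intros; lra.
  - intros; lra.
  - intros; lra.
Defined.

Definition I : Poset := sub Rposet (fun r => 0 <= r <= 1).

Definition monotone {P Q : Poset} (f : P -> Q) : Prop :=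
  forall x y, ple x y -> ple (f x) (f y).

Definition image {X Y : Type} (f : X -> Y) (S : X -> Prop) : Y -> Prop :=
  fun y => exists x, S x /\ f x = y.

Definition cofinal {P : Poset} (S : P -> Prop) : Prop :=
  forall x : P, exists y, S y /\ ple x y.

Definition lower {P : Poset} (S : P -> Prop) : Prop :=
  forall x y : P, ple x y -> S y -> S x.

Definition is_lub {P : Poset} (S : P -> Prop) (m : P) : Prop :=
  (forall y, S y -> ple y m) /\ (forall z, (forall y, S y -> ple y z) -> ple m z).

Definition is_glb {P : Poset} (S : P -> Prop) (m : P) : Prop :=
  (forall y, S y -> ple m y) /\ (forall z, (forall y, S y -> ple z y) -> ple z m).

Definition Doctrine := Poset -> Prop.

Definition join_doctrine (Phi : Doctrine) : Prop :=
  Phi unitP /\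
  (forall (P : Poset) (SS : (P -> Prop) -> Prop),
      (forall A, SS A -> Phi (sub P A)) ->
      Phi (sub (powerset P) SS) ->
      (forall x : P, exists A, SS A /\ A x) ->
      Phi P) /\
  (forall (P Q : Poset) (f : P -> Q),
      monotone f -> cofinal (image f (fun _ => True)) -> Phi P -> Phi Q) /\
  (forall (P : Poset) (S : P -> Prop), cofinal S -> Phi P -> Phi (sub P S)).

Definition PhiL (Phi : Doctrine) (X : Poset) (A : X -> Prop) : Prop :=
  lower A /\ Phi (sub X A).

Definition sound (Phi Psi : Doctrine) : Prop :=
  (forall (X Y : Poset) (phi : Y -> Prop) (psi : X -> Prop)
          (F : prodP (op X) Y -> boolP),
      PhiL Phi Y phi -> PhiL Psi X psi -> monotone F ->
      ((forall x : X, psi x -> exists y : Y, phi y /\ F (x, y) = true) <->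
       (exists y : Y, phi y /\ forall x : X, psi x -> F (x, y) = true))) /\
  (forall (X : Poset) (C : (X -> Prop) -> Prop),
      (forall A, C A -> lower A) ->
      (forall A, PhiL Psi X A -> C A) ->
      (forall SS : (X -> Prop) -> Prop,
          (forall A, SS A -> C A) -> Phi (sub (powerset X) SS) ->
          C (fun x => exists A, SS A /\ A x)) ->
      forall A, lower A -> C A).

Definition complete_lattice (X : Poset) : Prop :=
  forall S : X -> Prop, exists m, is_lub S m.

Definition way_below (Phi : Doctrine) (X : Poset) (y x : X) : Prop :=
  forall phi : X -> Prop, PhiL Phi X phi ->
    (forall j, is_lub phi j -> ple x j) -> phi y.

Definition cts_lattice (Phi : Doctrine) (X : Poset) : Prop :=
  complete_lattice X /\
  forall x : X, exists phi : X -> Prop,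
    PhiL Phi X phi /\ (forall y, phi y -> way_below Phi X y x) /\
    (forall j, is_lub phi j -> ple x j).

Definition ctsmor (Phi : Doctrine) (X Y : Poset) (f : X -> Y) : Prop :=
  (forall (S : X -> Prop) m, is_glb S m -> is_glb (image f S) (f m)) /\
  (forall (S : X -> Prop) m, Phi (sub X S) -> is_lub S m ->
     is_lub (image f S) (f m)).

Definition isU (u : I -> I) : Prop :=
  monotone u /\ forall y : I, exists x : I, u x = y.

Definition Uel := {u : I -> I | isU u}.

Record UPoset := { up :> Poset; act : Uel -> up -> up }.
Arguments act {u} _ _.

Definition is_UPoset (A : UPoset) : Prop :=
  (forall (u : Uel) (a : A), (forall t, proj1_sig u t = t) -> act u a = a) /\
  (forall (u v w : Uel) (a : A),
      (forall t, proj1_sig w t = proj1_sig u (proj1_sig v t)) ->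
      act w a = act u (act v a)) /\
  (forall (u v : Uel) (a b : A),
      (forall t, ple (proj1_sig u t) (proj1_sig v t)) -> ple a b ->
      ple (act u a) (act v b)).

Definition UInf (Psi : Doctrine) (A : UPoset) : Prop :=
  is_UPoset A /\
  (forall S : A -> Prop, Psi (op (sub A S)) -> exists m, is_glb S m) /\
  (forall (u : Uel) (S : A -> Prop) m, Psi (op (sub A S)) -> is_glb S m ->
      is_glb (image (act u) S) (act u m)).

Definition umor (Psi : Doctrine) (A B : UPoset) (f : A -> B) : Prop :=
  monotone f /\
  (forall (u : Uel) (a : A), f (act u a) = act u (f a)) /\
  (forall (S : A -> Prop) m, Psi (op (sub A S)) -> is_glb S m ->
      is_glb (image f S) (f m)).

Lemma tplus_in (t r : I) :
  0 <= Rmin (proj1_sig t + proj1_sig r) 1 <= 1.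
Proof.
  destruct t as [t ht], r as [r hr]; simpl.
  unfold Rmin; destruct (Rle_dec (t + r) 1); lra.
Qed.

Definition tplus (t r : I) : I :=
  exist _ (Rmin (proj1_sig t + proj1_sig r) 1) (tplus_in t r).

Definition le_r (A : UPoset) (a b : A) (r : I) : Prop :=
  forall u v : Uel,
    (forall t : I, ple (proj1_sig u (tplus t r)) (proj1_sig v t)) ->
    ple (act u a) (act v b).

Definition is_rho (A : UPoset) (a b : A) (d : I) : Prop :=
  is_glb (fun r : I => le_r A a b r) d.

Definition dist_lt (A : UPoset) (a b : A) (eps : R) : Prop :=
  forall d1 d2 : I, is_rho A a b d1 -> is_rho A b a d2 ->
    Rmax (proj1_sig d1) (proj1_sig d2) < eps.

Definition archimedean (A : UPoset) : Prop :=
  forall a b : A, (forall r : I, 0 < proj1_sig r -> le_r A a b r) -> ple a b.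

Definition dist_cauchy (A : UPoset) (x : nat -> A) : Prop :=
  forall eps, 0 < eps -> exists N, forall n m, (N <= n)%nat -> (N <= m)%nat ->
    dist_lt A (x n) (x m) eps.

Definition dist_converges (A : UPoset) (x : nat -> A) (a : A) : Prop :=
  forall eps, 0 < eps -> exists N, forall n, (N <= n)%nat -> dist_lt A (x n) a eps.

Definition completeU (A : UPoset) : Prop :=
  archimedean A /\
  forall x : nat -> A, dist_cauchy A x -> exists a, dist_converges A x a.

Definition iso_lo (u : Uel) (r : R) : Prop :=
  (forall s t : I, proj1_sig s <= r -> proj1_sig t <= r ->
     (ple s t <-> ple (proj1_sig u s) (proj1_sig u t))) /\
  (forall y : I, exists s : I, proj1_sig s <= r /\ proj1_sig u s = y).

Definition iso_hi (v : Uel) (r : R) : Prop :=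
  (forall s t : I, r <= proj1_sig s -> r <= proj1_sig t ->
     (ple s t <-> ple (proj1_sig v s) (proj1_sig v t))) /\
  (forall y : I, exists s : I, r <= proj1_sig s /\ proj1_sig v s = y).

Definition unstackable (A : UPoset) : Prop :=
  forall (r : R) (u v : Uel), 0 < r < 1 -> iso_lo u r -> iso_hi v r ->
    forall a b : A, ple (act u a) (act u b) -> ple (act v a) (act v b) -> ple a b.

Definition stackable (A : UPoset) : Prop :=
  unstackable A /\
  forall (r : R) (u v : Uel), 0 < r < 1 -> iso_lo u r -> iso_hi v r ->
    forall a b : A, (forall u' v' : Uel, ple (act v' b) (act u' a)) ->
      exists c : A, act u c = a /\ act v c = b.

Definition IU : UPoset := {| up := I; act := fun u t => proj1_sig u t |}.

Lemma is_lub_ext {P : Poset} (S T : P -> Prop) m :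
  (forall y, S y <-> T y) -> is_lub S m -> is_lub T m.
Proof.
  intros h [h1 h2]; split.
  - intros y hy; apply h1, h, hy.
  - intros z hz; apply h2; intros y hy; apply hz, h, hy.
Qed.

Lemma is_glb_ext {P : Poset} (S T : P -> Prop) m :
  (forall y, S y <-> T y) -> is_glb S m -> is_glb T m.
Proof.
  intros h [h1 h2]; split.
  - intros y hy; apply h1, h, hy.
  - intros z hz; apply h2; intros y hy; apply hz, h, hy.
Qed.

Lemma U_lub (u : I -> I) (S : I -> Prop) (m : I) :
  isU u -> is_lub S m -> is_lub (image u S) (u m).
Proof.
  intros [hmon hsur] [h1 h2]; split.
  - intros y [x [hx <-]]; apply hmon, h1, hx.
  - intros z hz.
    destruct (Rle_dec (proj1_sig (u m)) (proj1_sig z)) as [ok|nok]; [exact ok|].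
    exfalso; apply Rnot_le_lt in nok.
    set (w := (proj1_sig z + proj1_sig (u m)) / 2).
    assert (hw : 0 <= w <= 1).
    { destruct z as [zz hzz], (u m) as [um hum]; unfold w; simpl in *; lra. }
    destruct (hsur (exist _ w hw)) as [c hc].
    assert (hcm : ~ ple m c).
    { intros hle; pose proof (hmon _ _ hle) as hh; rewrite hc in hh;
        simpl in hh; unfold w in hh; simpl in *; lra. }
    assert (hex : exists y, S y /\ ~ ple y c).
    { apply not_all_not_ex; intros hn; apply hcm, h2; intros y hy.
      destruct (classic (ple y c)) as [e|e]; auto; exfalso; apply (hn y); tauto. }
    destruct hex as [y [hy hyc]].
    assert (hcy : ple c y).
    { destruct c as [cc hcc], y as [yy hyy]; simpl in *; apply Rnot_le_lt in hyc; lra. }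
    pose proof (hmon _ _ hcy) as h3.
    assert (h4 : ple (u y) z) by (apply hz; exists y; auto).
    rewrite hc in h3; simpl in h3.
    destruct z as [zz hzz], (u y) as [uy huy]; simpl in *; unfold w in *; lra.
Qed.

Lemma U_glb (u : I -> I) (S : I -> Prop) (m : I) :
  isU u -> is_glb S m -> is_glb (image u S) (u m).
Proof.
  intros [hmon hsur] [h1 h2]; split.
  - intros y [x [hx <-]]; apply hmon, h1, hx.
  - intros z hz.
    destruct (Rle_dec (proj1_sig z) (proj1_sig (u m))) as [ok|nok]; [exact ok|].
    exfalso; apply Rnot_le_lt in nok.
    set (w := (proj1_sig z + proj1_sig (u m)) / 2).
    assert (hw : 0 <= w <= 1).
    { destruct z as [zz hzz], (u m) as [um hum]; unfold w; simpl in *; lra. }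
    destruct (hsur (exist _ w hw)) as [c hc].
    assert (hcm : ~ ple c m).
    { intros hle; pose proof (hmon _ _ hle) as hh; rewrite hc in hh;
        simpl in hh; unfold w in hh; simpl in *; lra. }
    assert (hex : exists y, S y /\ ~ ple c y).
    { apply not_all_not_ex; intros hn; apply hcm, h2; intros y hy.
      destruct (classic (ple c y)) as [e|e]; auto; exfalso; apply (hn y); tauto. }
    destruct hex as [y [hy hyc]].
    assert (hcy : ple y c).
    { destruct c as [cc hcc], y as [yy hyy]; simpl in *; apply Rnot_le_lt in hyc; lra. }
    pose proof (hmon _ _ hcy) as h3.
    assert (h4 : ple z (u y)) by (apply hz; exists y; auto).
    rewrite hc in h3; simpl in h3.
    destruct z as [zz hzz], (u y) as [uy huy]; simpl in *; unfold w in *; lra.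
Qed.

Lemma ctsmor_postU (Phi : Doctrine) (X : Poset) (f : X -> I) (u : Uel) :
  ctsmor Phi X I f -> ctsmor Phi X I (fun x => proj1_sig u (f x)).
Proof.
  destruct u as [u hu]; simpl; intros [hm hj]; split.
  - intros S m hS.
    apply (is_glb_ext (image u (image f S))).
    + intros y; split.
      * intros [z [[x [hx <-]] <-]]; exists x; auto.
      * intros [x [hx <-]]; exists (f x); split; auto; exists x; auto.
    + apply U_glb; auto.
  - intros S m hP hS.
    apply (is_lub_ext (image u (image f S))).
    + intros y; split.
      * intros [z [[x [hx <-]] <-]]; exists x; auto.
      * intros [x [hx <-]]; exists (f x); split; auto; exists x; auto.
    + apply U_lub; auto.
Qed.

Definition HomC (Phi : Doctrine) (X : Poset) : UPoset :=
  {| up := sub (funposet X I) (ctsmor Phi X I);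
     act := fun u g => exist _ (fun x => proj1_sig u (proj1_sig g x))
                              (ctsmor_postU Phi X (proj1_sig g) u (proj2_sig g)) |}.

Definition HomU (Psi : Doctrine) (A : UPoset) : Poset :=
  sub (funposet A I) (umor Psi A IU).

(* Main.v *)
(* Soundness enters through one principle: a poset lies in [Phi] as soon as its
   [Psi]-subsets are bounded. Hence for every morphism [p : A -> I] the filter [p =
   1] is dually in [Phi], and the joins indexed by such filters show that [HomU A]
   is continuous and that every [p] on [HomC X] is the evaluation at a point of
   [X]. Points of a continuous lattice are separated by Urysohn functions, built
   from interpolation along the dyadic rationals. On the other side, the least
   morphism with [p a >= t] has an explicit description as an omega-indexed join,
   which yields [a <= b] slice by slice from [p a <= p b] for all [p] (Archimedean
   and unstackable); and a morphism [f : HomU A -> I] is uniformly approximated by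
   stacking elements of [A] that separate [f >= t] from [f < s]. *)

From Stdlib Require Import Reals Lra Lia Classical ClassicalEpsilon
  FunctionalExtensionality PropExtensionality.
Require Import Defs.
Open Scope R_scope.

(** * The unit interval and its monoid of surjective monotone maps *)

(** An abstract [A] carries no numerical values: that a value passes from below [s] to above [t] can
    only be expressed by acting with a map that is 0 up to [s] and 1 from [t] on. Ramps play this
    role throughout. A failed inequality is given strict room by an intermediate number, and a ramp
    across that room turns it into [1 <= 0]. The same room reduces the interchange of meets and
    joins in [I] to the two-valued interchange of soundness. Distances are treated once, for any
    family of equivariant maps to [I] that detects the order. The points of [X] do so for [HomC X]
    by definition; for [A] the morphisms to [I] do so only after the slicing argument, which is
    where omega in [Phi], the Archimedean property and unstackability enter. *)

Definition val (x : I) : R := proj1_sig x.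

Lemma val_bounds (x : I) : 0 <= val x <= 1.
Proof. exact (proj2_sig x). Qed.

Lemma Ile (x y : I) : val x <= val y -> ple x y.
Proof. exact (fun h => h). Qed.

Lemma val_le (x y : I) : ple x y -> val x <= val y.
Proof. exact (fun h => h). Qed.

Lemma val_inj (x y : I) : val x = val y -> x = y.
Proof. intros h; apply ple_anti; apply Ile; lra. Qed.

Definition mkI (r : R) (h : 0 <= r <= 1) : I := exist _ r h.

Lemma exI (r : R) : 0 <= r <= 1 -> exists x : I, val x = r.
Proof. intros h; exists (mkI r h); reflexivity. Qed.

Lemma val_tplus (t r : I) : val (tplus t r) = Rmin (val t + val r) 1.
Proof. reflexivity. Qed.

Lemma I_lub_ex (S : I -> Prop) : exists m : I, is_lub S m.
Proof.
  destruct (classic (exists x, S x)) as [[x0 hx0]|hn].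
  - destruct (completeness (fun r => exists x, S x /\ val x = r)) as [m [h1 h2]].
    + exists 1; intros r [x [_ <-]]; apply val_bounds.
    + exists (val x0), x0; auto.
    + assert (hm : 0 <= m <= 1).
      { split.
        - apply Rle_trans with (val x0); [apply val_bounds|].
          apply h1; exists x0; auto.
        - apply h2; intros r [x [_ <-]]; apply val_bounds. }
      exists (mkI m hm); split.
      * intros y hy; apply Ile; apply h1; exists y; auto.
      * intros z hz; apply Ile; apply h2; intros r [x [hx <-]].
        exact (hz x hx).
  - assert (h0 : 0 <= 0 <= 1) by lra.
    exists (mkI 0 h0); split.
    + intros y hy; exfalso; eauto.
    + intros z _; apply Ile; apply val_bounds.
Qed.

Lemma I_glb_ex (S : I -> Prop) : exists m : I, is_glb S m.
Proof.
  destruct (I_lub_ex (fun z => forall y, S y -> ple z y)) as [m [h1 h2]].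
  exists m; split.
  - intros y hy; apply h2; intros z hz; apply hz; auto.
  - intros z hz; apply h1; auto.
Qed.

Lemma I_lub_gt (S : I -> Prop) (m : I) (c : R) :
  is_lub S m -> 0 <= c < val m -> exists x, S x /\ c < val x.
Proof.
  intros [h1 h2] hc; apply NNPP; intros hn.
  pose proof (val_bounds m).
  destruct (exI c ltac:(lra)) as [c' hc'].
  assert (h : ple m c').
  { apply h2; intros y hy; apply Ile; apply Rnot_lt_le; intros hlt; apply hn.
    exists y; split; auto; lra. }
  apply val_le in h; lra.
Qed.

Lemma Rlt_between (x y : R) : x < y -> exists c, x < c < y.
Proof. intros h; exists ((x + y) / 2); lra. Qed.

Lemma lub_unique {P : Poset} (S : P -> Prop) m m' :
  is_lub S m -> is_lub S m' -> m = m'.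
Proof. intros [h1 h2] [h3 h4]; apply ple_anti; auto. Qed.

Lemma glb_unique {P : Poset} (S : P -> Prop) m m' :
  is_glb S m -> is_glb S m' -> m = m'.
Proof. intros [h1 h2] [h3 h4]; apply ple_anti; auto. Qed.

Definition app (u : Uel) (t : I) : I := proj1_sig u t.

Lemma app_mono (u : Uel) (s t : I) :
  val s <= val t -> val (app u s) <= val (app u t).
Proof. intros h; apply Ile; apply (proj2_sig u); exact h. Qed.

Lemma app_lt_inv (u : Uel) (s t : I) :
  val (app u s) < val (app u t) -> val s < val t.
Proof.
  intros h; apply Rnot_le_lt; intros hle; apply (app_mono u) in hle; lra.
Qed.

Lemma app_surj (u : Uel) (c : R) :
  0 <= c <= 1 -> exists x : I, val (app u x) = c.
Proof.
  intros h; destruct (proj2 (proj2_sig u) (mkI c h)) as [x hx].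
  exists x; unfold app; rewrite hx; reflexivity.
Qed.

Lemma app0 (u : Uel) (t : I) : val t = 0 -> val (app u t) = 0.
Proof.
  intros h; destruct (app_surj u 0 ltac:(lra)) as [x hx].
  pose proof (val_bounds x); pose proof (val_bounds (app u t)).
  assert (val (app u t) <= val (app u x)) by (apply app_mono; lra); lra.
Qed.

Lemma app1 (u : Uel) (t : I) : val t = 1 -> val (app u t) = 1.
Proof.
  intros h; destruct (app_surj u 1 ltac:(lra)) as [x hx].
  pose proof (val_bounds x); pose proof (val_bounds (app u t)).
  assert (val (app u x) <= val (app u t)) by (apply app_mono; lra); lra.
Qed.

Definition Ucomp (u v : Uel) : Uel.
Proof.
  exists (fun t => app u (app v t)); split.
  - intros x y h; apply Ile; do 2 apply app_mono; exact h.
  - intros y; destruct (proj2 (proj2_sig u) y) as [x hx].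
    destruct (proj2 (proj2_sig v) x) as [w hw].
    exists w; unfold app; rewrite hw; exact hx.
Defined.

Lemma app_comp (u v : Uel) (t : I) : app (Ucomp u v) t = app u (app v t).
Proof. reflexivity. Qed.

(** * Ramps: the piecewise linear elements of the monoid *)

Definition rampR (p q t : R) : R := Rmax 0 (Rmin 1 ((t - p) / (q - p))).

Lemma rampR_bounds p q t : 0 <= rampR p q t <= 1.
Proof.
  unfold rampR, Rmax, Rmin; repeat destruct Rle_dec; lra.
Qed.

Lemma rampR_cases p q t : p < q ->
  (t <= p /\ rampR p q t = 0) \/ (q <= t /\ rampR p q t = 1) \/
  (p <= t <= q /\ rampR p q t = (t - p) / (q - p)).
Proof.
  intros h; unfold rampR.
  assert (hd : (t - p) / (q - p) * (q - p) = t - p) by (field; lra).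
  set (d := (t - p) / (q - p)) in *.
  destruct (Rle_dec t p); [left|right; destruct (Rle_dec q t); [left|right]].
  - assert (d <= 0) by nra; split; auto.
    unfold Rmax, Rmin; repeat destruct Rle_dec; lra.
  - assert (1 <= d) by nra; split; auto.
    unfold Rmax, Rmin; repeat destruct Rle_dec; lra.
  - assert (0 <= d <= 1) by (split; nra); split; [lra|].
    unfold Rmax, Rmin; repeat destruct Rle_dec; lra.
Qed.

Lemma rampR_isU p q : 0 <= p < q -> q <= 1 ->
  isU (fun t => mkI (rampR p q (val t)) (rampR_bounds p q (val t))).
Proof.
  intros h1 h2; split.
  - intros x y h; apply val_le in h; apply Ile; unfold val at 1 3; simpl.
    unfold rampR; apply Rle_max_compat_l, Rle_min_compat_l.
    apply Rmult_le_compat_r; [|lra].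
    left; apply Rinv_0_lt_compat; lra.
  - intros y; pose proof (val_bounds y) as hy.
    assert (hx : 0 <= p + val y * (q - p) <= 1) by nra.
    exists (mkI _ hx); apply val_inj; unfold val at 1 2; simpl.
    unfold rampR.
    replace ((p + val y * (q - p) - p) / (q - p)) with (val y) by (field; lra).
    unfold Rmax, Rmin; repeat destruct Rle_dec; lra.
Qed.

Lemma id_isU : isU (fun t => t).
Proof. split; [intros x y h; exact h|eauto]. Qed.

(* Junk value: the identity when [0 <= p < q <= 1] fails. *)
Definition ramp (p q : R) : Uel :=
  match excluded_middle_informative (0 <= p < q /\ q <= 1) with
  | left h => exist _ _ (rampR_isU p q (proj1 h) (proj2 h))
  | right _ => exist _ _ id_isU
  end.

Lemma ramp_val p q t : 0 <= p < q -> q <= 1 ->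
  val (app (ramp p q) t) = rampR p q (val t).
Proof.
  intros h1 h2; unfold ramp, app.
  destruct excluded_middle_informative as [h|h]; [reflexivity|tauto].
Qed.

Lemma ramp_lo p q t : 0 <= p < q -> q <= 1 -> val t <= p ->
  val (app (ramp p q) t) = 0.
Proof.
  intros h1 h2 h; rewrite ramp_val; auto.
  destruct (rampR_cases p q (val t)) as [H|[H|H]]; try lra.
  destruct H as [H ->]; replace (val t) with p by lra; field; lra.
Qed.

Lemma ramp_hi p q t : 0 <= p < q -> q <= 1 -> q <= val t ->
  val (app (ramp p q) t) = 1.
Proof.
  intros h1 h2 h; rewrite ramp_val; auto.
  destruct (rampR_cases p q (val t)) as [H|[H|H]]; try lra.
  destruct H as [H ->]; replace (val t) with q by lra; field; lra.
Qed.

Lemma ramp_mid p q t : 0 <= p < q -> q <= 1 -> p <= val t <= q ->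
  val (app (ramp p q) t) = (val t - p) / (q - p).
Proof.
  intros h1 h2 h; rewrite ramp_val; auto.
  destruct (rampR_cases p q (val t)) as [[H ->]|[[H ->]|H]]; try tauto.
  - replace (val t) with p by lra; field; lra.
  - replace (val t) with q by lra; field; lra.
Qed.

Lemma ramp_gt0 p q t : 0 <= p < q -> q <= 1 -> 0 < val (app (ramp p q) t) ->
  p < val t.
Proof.
  intros h1 h2 h; apply Rnot_le_lt; intros hl; rewrite ramp_lo in h; auto; lra.
Qed.

Lemma ramp_eq1 p q t : 0 <= p < q -> q <= 1 -> val (app (ramp p q) t) = 1 ->
  q <= val t.
Proof.
  intros h1 h2 h; apply Rnot_lt_le; intros hl.
  destruct (Rle_dec (val t) p).
  - rewrite ramp_lo in h; auto; lra.
  - rewrite ramp_mid in h; auto; [|lra].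
    assert ((val t - p) / (q - p) * (q - p) = val t - p) by (field; lra).
    rewrite h in *; lra.
Qed.

Lemma ramp_iso_lo r : 0 < r < 1 -> iso_lo (ramp 0 r) r.
Proof.
  intros hr; split.
  - intros s t hs ht; change (val s <= r) in hs; change (val t <= r) in ht.
    change (val s <= val t <-> val (app (ramp 0 r) s) <= val (app (ramp 0 r) t)).
    pose proof (val_bounds s); pose proof (val_bounds t).
    rewrite !ramp_mid by lra.
    assert (h1 : (val s - 0) / (r - 0) * r = val s) by (field; lra).
    assert (h2 : (val t - 0) / (r - 0) * r = val t) by (field; lra).
    split; intros h.
    + apply Rmult_le_compat_r; [|lra]; left; apply Rinv_0_lt_compat; lra.
    + rewrite <- h1, <- h2; apply Rmult_le_compat_r; lra.
  - intros y; pose proof (val_bounds y).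
    destruct (exI (val y * r)) as [s hs]; [nra|].
    exists s; split; [change (val s <= r); nra|].
    apply val_inj; change (val (app (ramp 0 r) s) = val y).
    rewrite ramp_mid by nra; rewrite hs; field; lra.
Qed.

Lemma ramp_iso_hi r : 0 < r < 1 -> iso_hi (ramp r 1) r.
Proof.
  intros hr; split.
  - intros s t hs ht; change (r <= val s) in hs; change (r <= val t) in ht.
    change (val s <= val t <-> val (app (ramp r 1) s) <= val (app (ramp r 1) t)).
    pose proof (val_bounds s); pose proof (val_bounds t).
    rewrite !ramp_mid by lra.
    assert (h1 : (val s - r) / (1 - r) * (1 - r) = val s - r) by (field; lra).
    assert (h2 : (val t - r) / (1 - r) * (1 - r) = val t - r) by (field; lra).
    split; intros h.
    + apply Rmult_le_compat_r; [|lra]; left; apply Rinv_0_lt_compat; lra.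
    + assert (val s - r <= val t - r); [|lra].
      rewrite <- h1, <- h2; apply Rmult_le_compat_r; lra.
  - intros y; pose proof (val_bounds y).
    destruct (exI (r + val y * (1 - r))) as [s hs]; [nra|].
    exists s; split; [change (r <= val s); nra|].
    apply val_inj; change (val (app (ramp r 1) s) = val y).
    rewrite ramp_mid by nra; rewrite hs; field; lra.
Qed.

(** * Sound join doctrines *)

(** Closure under cofinal monotone images, applied to [g] corestricted to [T]. Nearly every
    membership in [Phi] below is obtained in this form. *)
Lemma doctrine_sub (Phi : Doctrine) (P Q : Poset) (g : P -> Q) (T : Q -> Prop) :
  join_doctrine Phi -> Phi P -> monotone g -> (forall x, T (g x)) ->
  (forall y, T y -> exists x, ple y (g x)) -> Phi (sub Q T).
Proof.
  intros (_ & _ & h3 & _) hP hg hT hc.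
  apply (h3 P (sub Q T) (fun x => exist _ (g x) (hT x))); [exact hg| |exact hP].
  intros [y hy]; destruct (hc y hy) as [x hx].
  exists (exist _ (g x) (hT x)); split; [exists x; auto|exact hx].
Qed.

Lemma doctrine_full (Phi : Doctrine) (P : Poset) :
  join_doctrine Phi -> Phi P -> PhiL Phi P (fun _ => True).
Proof.
  intros hj hP; split; [intros ? ? _ _; exact Logic.I|].
  apply (doctrine_sub Phi P P (fun x => x)); auto.
  - intros x y h; exact h.
  - intros y _; exists y; apply ple_refl.
Qed.

Lemma doctrine_down (Phi : Doctrine) (P : Poset) (S : P -> Prop) :
  join_doctrine Phi -> Phi (sub P S) ->
  PhiL Phi P (fun x => exists y, S y /\ ple x y).
Proof.
  intros hj hS; split.
  - intros x y h [z [hz h']]; exists z; split; auto; eapply ple_trans; eauto.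
  - apply (doctrine_sub Phi (sub P S) P (fun x => proj1_sig x)); auto.
    + intros x y h; exact h.
    + intros [x hx]; exists x; split; auto; apply ple_refl.
    + intros y [z [hz h]]; exists (exist _ z hz); exact h.
Qed.

Lemma doctrine_principal (Phi : Doctrine) (P : Poset) (p : P) :
  join_doctrine Phi -> PhiL Phi P (fun x => ple x p).
Proof.
  intros hj; split.
  - intros x y h h'; eapply ple_trans; eauto.
  - apply (doctrine_sub Phi unitP P (fun _ => p)); auto.
    + apply hj.
    + intros ? ? _; apply ple_refl.
    + intros _; apply ple_refl.
    + intros y hy; exists tt; exact hy.
Qed.

(** Condition (a) of soundness for whole posets and a relation in [Prop]; excluded middle makes the
    relation a map into 2. *)
Lemma interchange (Phi Psi : Doctrine) (P Q : Poset) (F : P -> Q -> Prop) :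
  join_doctrine Phi -> join_doctrine Psi -> sound Phi Psi -> Psi P -> Phi Q ->
  (forall x x' y y', ple x' x -> ple y y' -> F x y -> F x' y') ->
  (forall x, exists y, F x y) -> exists y, forall x, F x y.
Proof.
  intros hPhi hPsi [hs _] hP hQ hF hex.
  pose (G := fun z : prodP (op P) Q =>
    if excluded_middle_informative (F (fst z) (snd z)) then true else false).
  assert (hG : forall x y, G (x, y) = true <-> F x y).
  { intros x y; unfold G; simpl.
    destruct excluded_middle_informative; split; intros; tauto || discriminate. }
  destruct (hs P Q (fun _ => True) (fun _ => True) G) as [h _].
  - apply doctrine_full; auto.
  - apply doctrine_full; auto.
  - intros [x y] [x' y'] [h1 h2] h; simpl in h1, h2.
    apply hG; apply hG in h; exact (hF _ _ _ _ h1 h2 h).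
  - destruct h as [y [_ hy]].
    + intros x _; destruct (hex x) as [y hy]; exists y; split; auto.
      apply hG, hy.
    + exists y; intros x; apply hG, hy; exact Logic.I.
Qed.

Definition small_subsets (Psi : Doctrine) (P : Poset) (A : P -> Prop)
  : powerset P -> Prop := fun B => PhiL Psi P B /\ forall x, B x -> A x.

(* [Psi]-small lower sets are [Phi]-compact in the lattice of lower sets, so the
   lower sets that are [Phi]-unions of them are closed under [Phi]-unions. *)
Lemma small_subsets_doctrine (Phi Psi : Doctrine) (P : Poset) (A : P -> Prop) :
  join_doctrine Phi -> join_doctrine Psi -> sound Phi Psi -> lower A ->
  Phi (sub (powerset P) (small_subsets Psi P A)).
Proof.
  intros hPhi hPsi hs; revert A.
  assert (H : forall A, lower A ->
     lower A /\ Phi (sub (powerset P) (small_subsets Psi P A)));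
    [|intros A hA; apply H, hA].
  (* Induction by condition (b); the conjunct [lower A] is carried along because (b) asks the class
     to consist of lower sets. *)
  apply (proj2 hs P
    (fun A => lower A /\ Phi (sub (powerset P) (small_subsets Psi P A)))).
  - intros A h; apply h.
  - intros A hA; split; [apply hA|].
    (* A [Psi]-small [A] is the greatest of its own small subsets, so a single element is
       cofinal. *)
    apply (doctrine_sub Phi unitP (powerset P) (fun _ => A)); auto.
    + apply hPhi.
    + intros ? ? _; apply ple_refl.
    + intros _; split; auto.
    + intros B [_ hB]; exists tt; exact hB.
  - intros SS hSS hPS; split.
    { intros x y h [D [hD hy]]; exists D; split; auto.
      destruct (hSS D hD) as [hl _]; exact (hl _ _ h hy). }
    set (A := fun x => exists D, SS D /\ D x).
    set (Q := sub (powerset P) (small_subsets Psi P A)).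
    set (TD := fun (D : P -> Prop) (B : Q) => small_subsets Psi P D (proj1_sig B)).
    pose proof hPhi as (h1 & h2 & h3 & h4).
    (* [Q] is the union of the pieces [TD D], indexed by [SS], so the union axiom of [Phi]
       applies. *)
    apply (h2 Q (fun T => exists D, SS D /\ T = TD D)).
    + intros T [D [hD ->]].
      assert (inc : forall B : sub (powerset P) (small_subsets Psi P D),
                 small_subsets Psi P A (proj1_sig B)).
      { intros [B [hB1 hB2]]; split; auto; intros x hx; exists D; auto. }
      apply (doctrine_sub Phi (sub (powerset P) (small_subsets Psi P D)) Q
               (fun B => exist _ (proj1_sig B) (inc B))).
      * exact hPhi.
      * apply hSS, hD.
      * intros B B' h; exact h.
      * intros [B hB]; exact hB.
      * intros [B hB] hT; exists (exist _ B hT); apply (ple_refl (powerset P)).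
    + apply (doctrine_sub Phi (sub (powerset P) SS) (powerset Q)
               (fun D => TD (proj1_sig D))).
      * exact hPhi.
      * exact hPS.
      * intros [D hD] [D' hD'] h B [hB1 hB2]; split; [exact hB1|].
        intros x hx; apply h, hB2, hx.
      * intros [D hD]; exists D; auto.
      * intros T [D [hD ->]]; exists (exist _ D hD); apply (ple_refl (powerset Q)).
    + intros [B [hB1 hB2]].
      (* Compactness: each point of [B] lies in some [D], and soundness makes one [D] serve all of
         [B]. *)
      destruct (interchange Phi Psi (sub P B) (sub (powerset P) SS)
                  (fun x D => proj1_sig D (proj1_sig x))) as [[D hD] hall].
      * exact hPhi.
      * exact hPsi.
      * exact hs.
      * apply hB1.
      * exact hPS.
      * intros [x hx] [x' hx'] [D hD] [D' hD'] hxx hDD hin; simpl in *.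
        apply hDD; destruct (hSS D hD) as [hl _]; exact (hl _ _ hxx hin).
      * intros [x hx]; destruct (hB2 x hx) as [D [hD hDx]].
        exists (exist _ D hD); exact hDx.
      * exists (TD D); split; [exists D; auto|]; split; auto.
        intros x hx; exact (hall (exist _ x hx)).
Qed.

(** The poset of all [Psi]-small lower sets is in [Phi]. Boundedness makes the principal ones
    cofinal in it, so they form a member of [Phi], and sending a principal set to its generator
    carries this over to [P]. *)
Lemma doctrine_of_bounded (Phi Psi : Doctrine) (P : Poset) :
  join_doctrine Phi -> join_doctrine Psi -> sound Phi Psi ->
  (forall S : P -> Prop, Psi (sub P S) -> exists m, forall x, S x -> ple x m) ->
  Phi P.
Proof.
  intros hPhi hPsi hs hb.
  set (K := small_subsets Psi P (fun _ => True)).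
  assert (hK : Phi (sub (powerset P) K)).
  { apply (small_subsets_doctrine Phi Psi); auto; intros ? ? _ _; exact Logic.I. }
  assert (hprin : forall p, K (fun x => ple x p)).
  { intros p; split; auto; apply doctrine_principal; auto. }
  set (S := fun B : sub (powerset P) K =>
              exists p, proj1_sig B = (fun x => ple x p)).
  pose proof hPhi as (h1 & h2 & h3 & h4).
  assert (hS : Phi (sub _ S)).
  { apply h4; auto; intros [B hB].
    destruct (hb B) as [m hm]; [apply hB|].
    exists (exist _ _ (hprin m)); split; [exists m; reflexivity|exact hm]. }
  pose (f := fun B : sub _ S =>
    proj1_sig (constructive_indefinite_description _ (proj2_sig B))).
  assert (hf : forall B : sub _ S,
    proj1_sig (proj1_sig B) = (fun x => ple x (f B))).
  { intros B; unfold f; destruct constructive_indefinite_description; auto. }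
  apply (h3 (sub _ S) P f); auto.
  - intros B B' h.
    assert (h' : forall x, proj1_sig (proj1_sig B) x -> proj1_sig (proj1_sig B') x)
      by exact h.
    rewrite !hf in h'; apply h', ple_refl.
  - intros p.
    assert (hp : S (exist _ _ (hprin p))) by (exists p; reflexivity).
    exists (f (exist _ _ hp)); split; [eexists; split; eauto|].
    pose proof (hf (exist _ _ hp)) as e; simpl in e.
    change ((fun x => ple x (f (exist _ _ hp))) p); rewrite <- e; apply ple_refl.
Qed.

(** * Pointwise meets and joins in the hom-posets *)

Definition Iinf (S : I -> Prop) : I :=
  proj1_sig (constructive_indefinite_description _ (I_glb_ex S)).

Lemma Iinf_glb S : is_glb S (Iinf S).
Proof. unfold Iinf; destruct constructive_indefinite_description; auto. Qed.

Definition Isup (S : I -> Prop) : I :=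
  proj1_sig (constructive_indefinite_description _ (I_lub_ex S)).

Lemma Isup_lub S : is_lub S (Isup S).
Proof. unfold Isup; destruct constructive_indefinite_description; auto. Qed.

Definition ev {Psi : Doctrine} {A : UPoset} (a : A) (p : HomU Psi A) : I :=
  proj1_sig p a.

Definition evC {Phi : Doctrine} {X : Poset} (x : X) (f : HomC Phi X) : I :=
  proj1_sig f x.

Lemma ev_umor {Psi A} (p : HomU Psi A) : umor Psi A IU (fun a => ev a p).
Proof. exact (proj2_sig p). Qed.

Lemma evC_ctsmor {Phi X} (f : HomC Phi X) : ctsmor Phi X I (fun x => evC x f).
Proof. exact (proj2_sig f). Qed.

Lemma ev_act {Psi A} (p : HomU Psi A) (u : Uel) (a : A) :
  ev (act u a) p = app u (ev a p).
Proof. apply (ev_umor p). Qed.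

Lemma ev_mono {Psi A} (p : HomU Psi A) (a b : A) :
  ple a b -> val (ev a p) <= val (ev b p).
Proof. intros h; apply val_le; exact (proj1 (ev_umor p) a b h). Qed.

Lemma mono_of_glb {X Y : Poset} (f : X -> Y) :
  (forall (S : X -> Prop) m, is_glb S m -> is_glb (image f S) (f m)) -> monotone f.
Proof.
  intros hf x y h.
  destruct (hf (fun z => z = x \/ z = y) x) as [h1 _].
  - split.
    + intros z [->| ->]; auto; apply ple_refl.
    + intros z hz; apply hz; auto.
  - apply h1; exists y; auto.
Qed.

Lemma evC_mono {Phi X} (f : HomC Phi X) (x y : X) :
  ple x y -> val (evC x f) <= val (evC y f).
Proof.
  intros h; apply val_le.
  exact (mono_of_glb _ (proj1 (evC_ctsmor f)) x y h).
Qed.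

(** Any family [T] is allowed, since meets commute with meets and a surjective monotone self-map of
    [I] preserves all of them. *)
Lemma umor_inf (Psi : Doctrine) (A : UPoset) (T : HomU Psi A -> Prop) :
  umor Psi A IU (fun a => Iinf (image (ev a) T)).
Proof.
  split; [|split; [|intros S m hS hm; split]].
  - intros a b h; apply (Iinf_glb (image (ev b) T)); intros y [p [hp <-]].
    apply ple_trans with (ev a p).
    + apply (Iinf_glb (image (ev a) T)); exists p; auto.
    + apply Ile, ev_mono, h.
  - intros u a; apply (glb_unique (image (ev (act u a)) T)); [apply Iinf_glb|].
    apply (is_glb_ext (image (app u) (image (ev a) T))).
    + intros y; split.
      * intros [z [[p [hp <-]] <-]]; exists p; split; auto; apply ev_act.
      * intros [p [hp <-]]; exists (ev a p); split; [exists p; auto|].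
        symmetry; apply ev_act.
    + apply (U_glb (proj1_sig u)); [exact (proj2_sig u)|apply Iinf_glb].
  - intros y [a [ha <-]].
    apply (Iinf_glb (image (ev a) T)); intros y [p [hp <-]].
    apply ple_trans with (ev m p).
    + apply (Iinf_glb (image (ev m) T)); exists p; auto.
    + apply Ile, ev_mono, hm, ha.
  - intros z hz; apply (Iinf_glb (image (ev m) T)); intros y [p [hp <-]].
    apply (proj2 (proj2 (ev_umor p)) S m hS hm).
    intros y [a [ha <-]]; apply ple_trans with (Iinf (image (ev a) T)).
    + apply hz; exists a; auto.
    + apply (Iinf_glb (image (ev a) T)); exists p; auto.
Qed.

Lemma umor_sup (Phi Psi : Doctrine) (A : UPoset) (T : HomU Psi A -> Prop) :
  join_doctrine Phi -> join_doctrine Psi -> sound Phi Psi ->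
  Phi (sub (HomU Psi A) T) ->
  umor Psi A IU (fun a => Isup (image (ev a) T)).
Proof.
  intros hPhi hPsi hs hT.
  assert (hmon : forall a b : A, ple a b ->
             ple (Isup (image (ev a) T)) (Isup (image (ev b) T))).
  { intros a b h; apply (Isup_lub (image (ev a) T)); intros y [p [hp <-]].
    apply ple_trans with (ev b p); [apply Ile, ev_mono, h|].
    apply (Isup_lub (image (ev b) T)); exists p; auto. }
  split; [exact hmon|split].
  - intros u a; apply (lub_unique (image (ev (act u a)) T)); [apply Isup_lub|].
    apply (is_lub_ext (image (app u) (image (ev a) T))).
    + intros y; split.
      * intros [z [[p [hp <-]] <-]]; exists p; split; auto; apply ev_act.
      * intros [p [hp <-]]; exists (ev a p); split; [exists p; auto|].
        symmetry; apply ev_act.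
    + apply (U_lub (proj1_sig u)); [exact (proj2_sig u)|apply Isup_lub].
  - intros S m hS hm; split.
    { intros y [a [ha <-]]; apply hmon, hm, ha. }
    intros z hz; apply Ile, Rnot_lt_le; intros hlt.
    (* Cutting at a level [c] inside the gap turns the statement about [I] into one about the
       relation [c < p a], to which soundness applies. *)
    destruct (Rlt_between _ _ hlt) as [c hc].
    pose proof (val_bounds z) as hzb.
    pose proof (val_bounds (Isup (image (ev m) T))) as hjb.
    destruct (interchange Phi Psi (op (sub A S)) (sub (HomU Psi A) T)
       (fun a p => c < val (ev (proj1_sig a) (proj1_sig p)))) as [[p hp] hall]; auto.
    + intros [a ha] [a' ha'] [p hp] [p' hp'] h1 h2 h; simpl in *.
      apply Rlt_le_trans with (1 := h).
      apply Rle_trans with (val (ev a' p)); [apply ev_mono, h1|apply val_le, h2].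
    + intros [a ha]; simpl.
      assert (haz : val z <= val (Isup (image (ev a) T)))
        by (apply val_le, hz; exists a; auto).
      destruct (I_lub_gt _ _ c (Isup_lub (image (ev a) T))) as [y [[p [hp <-]] h]];
        [lra|].
      exists (exist _ p hp); exact h.
    + destruct (exI c ltac:(lra)) as [c' hc'].
      assert (h1 : ple c' (ev m p)).
      { apply (proj2 (proj2 (ev_umor p)) S m hS hm).
        intros y [a [ha <-]]; apply Ile; specialize (hall (exist _ a ha)).
        simpl in hall; lra. }
      assert (h2 : ple (ev m p) (Isup (image (ev m) T)))
        by (apply Isup_lub; exists p; auto).
      apply val_le in h1; apply val_le in h2; lra.
Qed.

Lemma ctsmor_inf (Phi Psi : Doctrine) (X : Poset) (T : HomC Phi X -> Prop) :
  join_doctrine Phi -> join_doctrine Psi -> sound Phi Psi ->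
  Psi (op (sub (HomC Phi X) T)) ->
  ctsmor Phi X I (fun x => Iinf (image (evC x) T)).
Proof.
  intros hPhi hPsi hs hT.
  assert (hmon : forall x y : X, ple x y ->
             ple (Iinf (image (evC x) T)) (Iinf (image (evC y) T))).
  { intros x y h; apply (Iinf_glb (image (evC y) T)); intros w [p [hp <-]].
    apply ple_trans with (evC x p); [|apply Ile, evC_mono, h].
    apply (Iinf_glb (image (evC x) T)); exists p; auto. }
  split.
  - intros S m hm; split.
    { intros y [a [ha <-]]; apply hmon, hm, ha. }
    intros z hz; apply (Iinf_glb (image (evC m) T)); intros w [p [hp <-]].
    apply (proj1 (evC_ctsmor p) S m hm); intros y [x [hx <-]].
    apply ple_trans with (Iinf (image (evC x) T)); [apply hz; exists x; auto|].
    apply (Iinf_glb (image (evC x) T)); exists p; auto.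
  - intros S m hS hm; split.
    { intros y [a [ha <-]]; apply hmon, hm, ha. }
    intros z hz; apply Ile, Rnot_lt_le; intros hlt.
    destruct (Rlt_between _ _ hlt) as [c hc].
    pose proof (val_bounds z) as hzb.
    pose proof (val_bounds (Iinf (image (evC m) T))) as hjb.
    destruct (interchange Phi Psi (op (sub (HomC Phi X) T)) (sub X S)
       (fun p x => c < val (evC (proj1_sig x) (proj1_sig p)))) as [[x hx] hall]; auto.
    + intros [p hp] [p' hp'] [x hx] [x' hx'] h1 h2 h; simpl in *.
      apply Rlt_le_trans with (1 := h).
      apply Rle_trans with (val (evC x' p)); [apply evC_mono, h2|apply val_le, h1].
    + intros [p hp]; simpl.
      assert (haz : val (Iinf (image (evC m) T)) <= val (evC m p))
        by (apply val_le, Iinf_glb; exists p; auto).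
      destruct (I_lub_gt _ _ c (proj2 (evC_ctsmor p) S m hS hm))
        as [y [[x [hx <-]] h]]; [lra|].
      exists (exist _ x hx); exact h.
    + destruct (exI c ltac:(lra)) as [c' hc'].
      assert (h1 : ple c' (Iinf (image (evC x) T))).
      { apply Iinf_glb; intros y [p [hp <-]]; apply Ile.
        specialize (hall (exist _ p hp)); simpl in hall; lra. }
      assert (h2 : ple (Iinf (image (evC x) T)) z) by (apply hz; exists x; auto).
      apply val_le in h1; apply val_le in h2; lra.
Qed.

Definition infU {Psi : Doctrine} {A : UPoset} (T : HomU Psi A -> Prop)
  : HomU Psi A := exist _ _ (umor_inf Psi A T).

Lemma infU_glb {Psi A} (T : HomU Psi A -> Prop) : is_glb T (infU T).
Proof.
  split.
  - intros p hp a; apply (Iinf_glb (image (ev a) T)); exists p; auto.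
  - intros p hp a; apply (Iinf_glb (image (ev a) T)); intros y [q [hq <-]].
    exact (hp q hq a).
Qed.

Lemma ev_glb {Psi A} (T : HomU Psi A -> Prop) m (a : A) :
  is_glb T m -> is_glb (image (ev a) T) (ev a m).
Proof.
  intros h; rewrite (glb_unique T m _ h (infU_glb T)).
  apply (Iinf_glb (image (ev a) T)).
Qed.

Lemma ev_lub (Phi : Doctrine) {Psi A} (T : HomU Psi A -> Prop) m (a : A) :
  join_doctrine Phi -> join_doctrine Psi -> sound Phi Psi ->
  Phi (sub (HomU Psi A) T) -> is_lub T m -> is_lub (image (ev a) T) (ev a m).
Proof.
  intros hPhi hPsi hs hT h.
  set (j := exist _ _ (umor_sup Phi Psi A T hPhi hPsi hs hT) : HomU Psi A).
  assert (hj : is_lub T j).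
  { split.
    - intros p hp b; apply (Isup_lub (image (ev b) T)); exists p; auto.
    - intros p hp b; apply (Isup_lub (image (ev b) T)); intros y [q [hq <-]].
      exact (hp q hq b). }
  rewrite (lub_unique T m _ h hj); apply (Isup_lub (image (ev a) T)).
Qed.

Lemma ev_ctsmor (Phi Psi : Doctrine) (A : UPoset) (a : A) :
  join_doctrine Phi -> join_doctrine Psi -> sound Phi Psi ->
  ctsmor Phi (HomU Psi A) I (ev a).
Proof.
  intros hPhi hPsi hs; split.
  - intros S m; apply ev_glb.
  - intros S m; apply (ev_lub Phi); auto.
Qed.

Lemma HomU_complete (Psi : Doctrine) (A : UPoset) : complete_lattice (HomU Psi A).
Proof.
  intros S; destruct (infU_glb (fun q => forall p, S p -> ple p q)) as [h1 h2].
  eexists; split.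
  - intros p hp; apply h2; intros q hq; apply hq, hp.
  - intros q hq; apply h1; exact hq.
Qed.

Lemma HomC_glb_ex (Phi Psi : Doctrine) (X : Poset) (T : HomC Phi X -> Prop) :
  join_doctrine Phi -> join_doctrine Psi -> sound Phi Psi ->
  Psi (op (sub (HomC Phi X) T)) ->
  exists m, is_glb T m /\ forall x, is_glb (image (evC x) T) (evC x m).
Proof.
  intros hPhi hPsi hs hT.
  exists (exist _ _ (ctsmor_inf Phi Psi X T hPhi hPsi hs hT)); split; [split|].
  - intros p hp x; apply (Iinf_glb (image (evC x) T)); exists p; auto.
  - intros p hp x; apply (Iinf_glb (image (evC x) T)); intros y [q [hq <-]].
    exact (hp q hq x).
  - intros x; apply (Iinf_glb (image (evC x) T)).
Qed.

Lemma evC_glb (Phi Psi : Doctrine) (X : Poset) (T : HomC Phi X -> Prop) m (x : X) :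
  join_doctrine Phi -> join_doctrine Psi -> sound Phi Psi ->
  Psi (op (sub (HomC Phi X) T)) ->
  is_glb T m -> is_glb (image (evC x) T) (evC x m).
Proof.
  intros hPhi hPsi hs hT h.
  destruct (HomC_glb_ex Phi Psi X T) as [m' [hm' hx]]; auto.
  rewrite (glb_unique T m m' h hm'); apply hx.
Qed.

Lemma evC_umor (Phi Psi : Doctrine) (X : Poset) (x : X) :
  join_doctrine Phi -> join_doctrine Psi -> sound Phi Psi ->
  umor Psi (HomC Phi X) IU (evC x).
Proof.
  intros hPhi hPsi hs; split; [|split].
  - intros f g h; exact (h x).
  - reflexivity.
  - intros S m hS; apply (evC_glb Phi Psi); auto.
Qed.

(** * Distances detected by a separating family of equivariant maps *)

(** [K] is a set of test points for [A]. It is used with the points of [X] for [HomC X], and with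
    the morphisms to [I] for an abstract inflattice; [rho] then becomes the supremum of truncated
    differences. *)
Definition separating (A : UPoset) (K : Type) (E : K -> A -> I) : Prop :=
  (forall k u a, E k (act u a) = app u (E k a)) /\
  (forall a b, ple a b <-> forall k, val (E k a) <= val (E k b)).

Lemma le_r_iff (A : UPoset) (K : Type) (E : K -> A -> I) (a b : A) (r : I) :
  separating A K E ->
  (le_r A a b r <-> forall k, val (E k a) <= val (E k b) + val r).
Proof.
  intros [hact hle]; split.
  - intros h k; apply Rnot_lt_le; intros hlt.
    pose proof (val_bounds (E k a)) as h1; pose proof (val_bounds (E k b)) as h2.
    pose proof (val_bounds r) as h3.
    set (x := val (E k a)) in *; set (y := val (E k b)) in *; set (c := val r) in *.
    (* The second ramp is the first translated down by [c], so the pair is admissible for [le_r];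
       yet it sends [x] to 1 and [y] to 0. *)
    assert (hk : ple (act (ramp (y + c) x) a) (act (ramp y (x - c)) b)).
    { apply h; intros t; apply Ile.
      change (val (app (ramp (y + c) x) (tplus t r)) <=
              val (app (ramp y (x - c)) t)).
      pose proof (val_bounds t) as ht.
      destruct (Rle_dec (val t) y).
      - rewrite ramp_lo; try lra; [apply val_bounds|].
        rewrite val_tplus; apply Rle_trans with (1 := Rmin_l _ _); fold c; lra.
      - destruct (Rle_dec (x - c) (val t)).
        + rewrite (ramp_hi y (x - c)); try lra; apply val_bounds.
        + assert (e : val (tplus t r) = val t + c)
            by (rewrite val_tplus; fold c; apply Rmin_left; lra).
          rewrite !ramp_mid by lra; rewrite e; right; field; lra. }
    apply (proj1 (hle _ _)) with (k := k) in hk.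
    rewrite !hact, ramp_hi, ramp_lo in hk by (fold x y; lra); lra.
  - intros h u v huv; apply hle; intros k; rewrite !hact.
    apply Rle_trans with (val (app u (tplus (E k b) r))).
    + apply app_mono; rewrite val_tplus; apply Rmin_glb; auto; apply val_bounds.
    + exact (huv (E k b)).
Qed.

Lemma archimedean_separating (A : UPoset) (K : Type) (E : K -> A -> I) :
  separating A K E -> archimedean A.
Proof.
  intros hE a b h; apply hE; intros k; apply Rnot_lt_le; intros hlt.
  pose proof (val_bounds (E k a)); pose proof (val_bounds (E k b)).
  destruct (exI ((val (E k a) - val (E k b)) / 2)) as [r hr]; [lra|].
  assert (h' := proj1 (le_r_iff A K E a b r hE) (h r ltac:(change (0 < val r); lra)) k).
  lra.
Qed.

Lemma rho_ge (A : UPoset) (K : Type) (E : K -> A -> I) (a b : A) (d : I) (k : K) :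
  separating A K E -> is_rho A a b d -> val (E k a) <= val (E k b) + val d.
Proof.
  intros hE [_ hd].
  pose proof (val_bounds (E k a)); pose proof (val_bounds (E k b)).
  destruct (Rle_dec (val (E k a)) (val (E k b))).
  - pose proof (val_bounds d); lra.
  - destruct (exI (val (E k a) - val (E k b))) as [c hc]; [lra|].
    assert (hcd : ple c d).
    { apply hd; intros r hr; apply Ile.
      assert (h := proj1 (le_r_iff A K E a b r hE) hr k); lra. }
    apply val_le in hcd; lra.
Qed.

Lemma dist_lt_elim (A : UPoset) (K : Type) (E : K -> A -> I) (a b : A) (e : R) :
  separating A K E -> dist_lt A a b e ->
  forall k, Rabs (val (E k a) - val (E k b)) < e.
Proof.
  intros hE h k.
  destruct (I_glb_ex (fun r => le_r A a b r)) as [d1 hd1].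
  destruct (I_glb_ex (fun r => le_r A b a r)) as [d2 hd2].
  specialize (h d1 d2 hd1 hd2).
  apply Rmax_Rlt in h; destruct h as [h1 h2].
  change (val d1 < e) in h1; change (val d2 < e) in h2.
  pose proof (rho_ge A K E a b d1 k hE hd1).
  pose proof (rho_ge A K E b a d2 k hE hd2).
  apply Rabs_def1; lra.
Qed.

Lemma dist_lt_intro (A : UPoset) (K : Type) (E : K -> A -> I) (a b : A) (r e : R) :
  separating A K E -> 0 <= r < e ->
  (forall k, Rabs (val (E k a) - val (E k b)) <= r) -> dist_lt A a b e.
Proof.
  intros hE hr h d1 d2 hd1 hd2.
  (* Differences in [I] never exceed 1, so truncating [r] loses nothing and makes it an element of
     [I]. *)
  assert (hr' : 0 <= Rmin r 1 <= 1)
    by (split; [apply Rmin_glb; lra|apply Rmin_r]).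
  destruct (exI _ hr') as [c hc].
  assert (hk : forall k, val (E k a) <= val (E k b) + val c /\
                         val (E k b) <= val (E k a) + val c).
  { intros k; rewrite hc; specialize (h k).
    pose proof (val_bounds (E k a)); pose proof (val_bounds (E k b)).
    unfold Rabs in h; destruct Rcase_abs;
      unfold Rmin; destruct Rle_dec; lra. }
  assert (hc' : val c <= r) by (rewrite hc; apply Rmin_l).
  assert (h1 : val d1 <= val c).
  { apply val_le, hd1; apply (le_r_iff A K E a b c hE); intros k; apply hk. }
  assert (h2 : val d2 <= val c).
  { apply val_le, hd2; apply (le_r_iff A K E b a c hE); intros k; apply hk. }
  apply Rmax_lub_lt; [change (val d1 < e)|change (val d2 < e)]; lra.
Qed.

(** * Morphisms from a lattice to the interval *)

Lemma HomC_separating (Phi : Doctrine) (X : Poset) :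
  separating (HomC Phi X) X evC.
Proof. split; [reflexivity|]. intros f g; reflexivity. Qed.

Lemma HomC_ext {Phi X} (f g : HomC Phi X) : (forall x, evC x f = evC x g) -> f = g.
Proof.
  intros h; apply ple_anti; intros x.
  - change (ple (evC x f) (evC x g)); rewrite h; apply ple_refl.
  - change (ple (evC x g) (evC x f)); rewrite h; apply ple_refl.
Qed.

Lemma HomU_ext {Psi A} (p q : HomU Psi A) : (forall a, ev a p = ev a q) -> p = q.
Proof.
  intros h; apply ple_anti; intros a.
  - change (ple (ev a p) (ev a q)); rewrite h; apply ple_refl.
  - change (ple (ev a q) (ev a p)); rewrite h; apply ple_refl.
Qed.

Lemma HomC_UInf (Phi Psi : Doctrine) (X : Poset) :
  join_doctrine Phi -> join_doctrine Psi -> sound Phi Psi -> UInf Psi (HomC Phi X).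
Proof.
  intros hPhi hPsi hs; split; [split; [|split]|split].
  - intros u f hu; apply HomC_ext; intros x; exact (hu (evC x f)).
  - intros u v w f hw; apply HomC_ext; intros x; exact (hw (evC x f)).
  - intros u v f g huv hfg x.
    apply ple_trans with (app u (evC x g)); [|exact (huv (evC x g))].
    apply Ile, app_mono, val_le, (hfg x).
  - intros S hS; destruct (HomC_glb_ex Phi Psi X S) as [m [hm _]]; eauto.
  - intros u S m hS hm; split.
    + intros y [f [hf <-]] x; apply Ile; apply (app_mono u).
      apply val_le; exact (proj1 hm f hf x).
    + intros z hz x.
      apply (U_glb (proj1_sig u) (image (evC x) S) (evC x m) (proj2_sig u)).
      * apply (evC_glb Phi Psi); auto.
      * intros y [w [[f [hf <-]] <-]].
        exact (hz (act u f) (ex_intro _ f (conj hf eq_refl)) x).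
Qed.

Lemma Rabs_le_inv (x e : R) : Rabs x <= e -> - e <= x <= e.
Proof. intros h; unfold Rabs in h; destruct Rcase_abs; lra. Qed.

(** If [l] failed to preserve a meet or join, the gap would be spanned by two errors of the
    approximation, one on [S] and one at [m]; an error of one third of the gap excludes this. *)
Lemma ctsmor_uniform_limit (Phi : Doctrine) (X : Poset) (l : X -> I) :
  (forall e, 0 < e -> exists f : HomC Phi X,
     forall x, Rabs (val (evC x f) - val (l x)) <= e) ->
  ctsmor Phi X I l.
Proof.
  intros h.
  assert (hmon : forall x y, ple x y -> ple (l x) (l y)).
  { intros x y hxy; apply Ile, Rnot_lt_le; intros hlt.
    destruct (h ((val (l x) - val (l y)) / 3)) as [f hf]; [lra|].
    pose proof (Rabs_le_inv _ _ (hf x)); pose proof (Rabs_le_inv _ _ (hf y)).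
    pose proof (evC_mono f x y hxy); lra. }
  split.
  - intros S m hm; split.
    { intros y [x [hx <-]]; apply hmon, hm, hx. }
    intros z hz; apply Ile, Rnot_lt_le; intros hlt.
    pose proof (val_bounds z); pose proof (val_bounds (l m)).
    set (e := (val z - val (l m)) / 3).
    destruct (h e) as [f hf]; [unfold e; lra|].
    destruct (exI (val z - e)) as [c hc]; [unfold e; lra|].
    assert (h1 : ple c (evC m f)).
    { apply (proj1 (evC_ctsmor f) S m hm); intros y [x [hx <-]]; apply Ile.
      assert (hzx : val z <= val (l x)) by (apply val_le, hz; exists x; auto).
      pose proof (Rabs_le_inv _ _ (hf x)); unfold e in *; lra. }
    apply val_le in h1; pose proof (Rabs_le_inv _ _ (hf m)); unfold e in *; lra.
  - intros S m hS hm; split.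
    { intros y [x [hx <-]]; apply hmon, hm, hx. }
    intros z hz; apply Ile, Rnot_lt_le; intros hlt.
    pose proof (val_bounds z); pose proof (val_bounds (l m)).
    set (e := (val (l m) - val z) / 3).
    destruct (h e) as [f hf]; [unfold e; lra|].
    destruct (exI (val z + e)) as [c hc]; [unfold e; lra|].
    assert (h1 : ple (evC m f) c).
    { apply (proj2 (evC_ctsmor f) S m hS hm); intros y [x [hx <-]]; apply Ile.
      assert (hzx : val (l x) <= val z) by (apply val_le, hz; exists x; auto).
      pose proof (Rabs_le_inv _ _ (hf x)); unfold e in *; lra. }
    apply val_le in h1; pose proof (Rabs_le_inv _ _ (hf m)); unfold e in *; lra.
Qed.

(** A [dist]-Cauchy sequence is uniformly Cauchy on [X], so its pointwise limit is a uniform one. *)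
Lemma HomC_completeU (Phi : Doctrine) (X : Poset) : completeU (HomC Phi X).
Proof.
  pose proof (HomC_separating Phi X) as hE; split.
  { eapply archimedean_separating; eauto. }
  intros f hf.
  assert (hC : forall e, 0 < e -> exists N, forall n m, (N <= n)%nat -> (N <= m)%nat ->
     forall x, Rabs (val (evC x (f n)) - val (evC x (f m))) < e).
  { intros e he; destruct (hf e he) as [N hN]; exists N; intros n m hn hm.
    apply (dist_lt_elim _ _ _ _ _ _ hE); auto. }
  assert (hl : forall x, exists y : I, Un_cv (fun n => val (evC x (f n))) (val y)).
  { intros x; destruct (R_complete (fun n => val (evC x (f n)))) as [l hl].
    - intros e he; destruct (hC e he) as [N hN]; exists N; intros n m hn hm.
      apply hN; auto.
    - assert (hb : 0 <= l <= 1).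
      { split; apply Rnot_lt_le; intros hlt.
        - destruct (hl (- l)) as [N hN]; [lra|].
          specialize (hN N (le_n N)); apply Rabs_def2 in hN.
          pose proof (val_bounds (evC x (f N))); lra.
        - destruct (hl (l - 1)) as [N hN]; [lra|].
          specialize (hN N (le_n N)); apply Rabs_def2 in hN.
          pose proof (val_bounds (evC x (f N))); lra. }
      exists (mkI l hb); exact hl. }
  pose (l := fun x => proj1_sig (constructive_indefinite_description _ (hl x))).
  assert (hcv : forall x, Un_cv (fun n => val (evC x (f n))) (val (l x))).
  { intros x; unfold l; destruct constructive_indefinite_description; auto. }
  assert (hu : forall e, 0 < e -> exists N, forall n, (N <= n)%nat ->
     forall x, Rabs (val (evC x (f n)) - val (l x)) <= e).
  { intros e he; destruct (hC (e / 2)) as [N hN]; [lra|].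
    exists N; intros n hn x.
    destruct (hcv x (e / 2)) as [M hM]; [lra|].
    specialize (hM (max N M) ltac:(lia)); specialize (hN n (max N M) hn ltac:(lia) x).
    unfold Rdist in hM; apply Rabs_def2 in hM; apply Rabs_def2 in hN.
    apply Rabs_le; lra. }
  assert (hl' : ctsmor Phi X I l).
  { apply ctsmor_uniform_limit; intros e he; destruct (hu e he) as [N hN].
    exists (f N); apply hN; auto. }
  exists (exist _ l hl'); intros e he.
  destruct (hu (e / 2)) as [N hN]; [lra|].
  exists N; intros n hn.
  apply (dist_lt_intro _ _ _ _ _ (e / 2) _ hE); [lra|].
  intros x; apply (hN n hn x).
Qed.

Lemma I_unstack (u v : Uel) (r : R) (s t : I) :
  0 < r < 1 -> iso_lo u r -> iso_hi v r ->
  val (app u s) <= val (app u t) -> val (app v s) <= val (app v t) ->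
  val s <= val t.
Proof.
  intros hr [hu _] [hv _] h1 h2; apply Rnot_lt_le; intros hlt.
  pose proof (val_bounds s) as hs; pose proof (val_bounds t) as ht.
  destruct (Rlt_dec (val t) r) as [htr|htr].
  (* [u] is only known to be injective up to [r], so [s] is replaced by the smaller of [s] and [r],
     which still exceeds [t]. *)
  - assert (hb : 0 <= Rmin (val s) r <= 1)
      by (unfold Rmin; destruct Rle_dec; lra).
    destruct (exI _ hb) as [s' hs'].
    assert (hs1 : val s' <= r) by (rewrite hs'; apply Rmin_r).
    assert (hs2 : val s' <= val s) by (rewrite hs'; apply Rmin_l).
    assert (hs3 : val t < val s') by (rewrite hs'; apply Rmin_glb_lt; lra).
    assert (h3 : ple s' t).
    { apply (hu s' t); [exact hs1|change (val t <= r); lra|].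
      apply Ile; apply (app_mono u) in hs2; unfold app in *; lra. }
    apply val_le in h3; lra.
  - assert (h3 : ple s t).
    { apply (hv s t); [change (r <= val s); lra|change (r <= val t); lra|].
      exact h2. }
    apply val_le in h3; lra.
Qed.

(** The disjunction is the pointwise content of the hypothesis of stackability. If [b] is 0, then
    [c] is found in [[0,r]], where [v] vanishes; if [a] is 1, it is found in [[r,1]], where [u] is
    1. *)
Lemma I_stack (u v : Uel) (r : R) (a b : I) :
  0 < r < 1 -> iso_lo u r -> iso_hi v r -> val b = 0 \/ val a = 1 ->
  exists c, app u c = a /\ app v c = b.
Proof.
  intros hr [_ hu] [_ hv] [h|h].
  - destruct (hu a) as [s [hs1 hs2]]; exists s; split; [exact hs2|].
    destruct (hv b) as [t [ht1 ht2]].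
    change (val s <= r) in hs1; change (r <= val t) in ht1.
    assert (h1 : val (app v s) <= val (app v t)) by (apply app_mono; lra).
    assert (h2 : app v t = b) by exact ht2; rewrite h2 in h1.
    apply val_inj; pose proof (val_bounds (app v s)); lra.
  - destruct (hv b) as [s [hs1 hs2]]; exists s; split; [|exact hs2].
    destruct (hu a) as [t [ht1 ht2]].
    change (r <= val s) in hs1; change (val t <= r) in ht1.
    assert (h1 : val (app u t) <= val (app u s)) by (apply app_mono; lra).
    assert (h2 : app u t = a) by exact ht2; rewrite h2 in h1.
    apply val_inj; pose proof (val_bounds (app u s)); lra.
Qed.

Lemma HomC_stackable (Phi : Doctrine) (X : Poset) : stackable (HomC Phi X).
Proof.
  split.
  - intros r u v hr hu hv f g h1 h2 x; apply Ile.
    apply (I_unstack u v r (evC x f) (evC x g)); auto.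
    + apply val_le, (h1 x).
    + apply val_le, (h2 x).
  - intros r u v hr hu hv a b h.
    assert (hx : forall x, exists c, app u c = evC x a /\ app v c = evC x b).
    { intros x; apply (I_stack u v r); auto.
      apply NNPP; intros hn.
      pose proof (val_bounds (evC x a)); pose proof (val_bounds (evC x b)).
      assert (h1 : 0 < val (evC x b)) by lra.
      assert (h2 : val (evC x a) < 1) by lra.
      (* These maps send [b x] to 1 and [a x] to 0. *)
      pose proof (h (ramp (val (evC x a)) 1) (ramp 0 (val (evC x b))) x) as h3.
      change (val (app (ramp 0 (val (evC x b))) (evC x b)) <=
              val (app (ramp (val (evC x a)) 1) (evC x a))) in h3.
      rewrite ramp_hi, ramp_lo in h3; lra. }
    pose (c := fun x => proj1_sig (constructive_indefinite_description _ (hx x))).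
    assert (hcu : forall x, app u (c x) = evC x a).
    { intros x.
      exact (proj1 (proj2_sig (constructive_indefinite_description _ (hx x)))). }
    assert (hcv : forall x, app v (c x) = evC x b).
    { intros x.
      exact (proj2 (proj2_sig (constructive_indefinite_description _ (hx x)))). }
    (* Every inequality for [c] is tested through [u] and [v], whose composites with [c] are the
       morphisms [a] and [b]. *)
    assert (hc : ctsmor Phi X I c).
    { assert (hmon : forall x y, ple x y -> ple (c x) (c y)).
      { intros x y hxy; apply Ile, (I_unstack u v r); auto.
        - rewrite !hcu; apply evC_mono, hxy.
        - rewrite !hcv; apply evC_mono, hxy. }
      split.
      - intros S m hm; split.
        { intros y [x [hx' <-]]; apply hmon, hm, hx'. }
        intros z hz; apply Ile, (I_unstack u v r); auto.
        + rewrite hcu; apply val_le, (proj1 (evC_ctsmor a) S m hm).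
          intros y [x [hx' <-]]; apply Ile; rewrite <- hcu; apply app_mono.
          apply val_le, hz; exists x; auto.
        + rewrite hcv; apply val_le, (proj1 (evC_ctsmor b) S m hm).
          intros y [x [hx' <-]]; apply Ile; rewrite <- hcv; apply app_mono.
          apply val_le, hz; exists x; auto.
      - intros S m hS hm; split.
        { intros y [x [hx' <-]]; apply hmon, hm, hx'. }
        intros z hz; apply Ile, (I_unstack u v r); auto.
        + rewrite hcu; apply val_le, (proj2 (evC_ctsmor a) S m hS hm).
          intros y [x [hx' <-]]; apply Ile; rewrite <- hcu; apply app_mono.
          apply val_le, hz; exists x; auto.
        + rewrite hcv; apply val_le, (proj2 (evC_ctsmor b) S m hS hm).
          intros y [x [hx' <-]]; apply Ile; rewrite <- hcv; apply app_mono.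
          apply val_le, hz; exists x; auto. }
    exists (exist _ c hc); split; apply HomC_ext; intros x; [apply hcu|apply hcv].
Qed.

(** * Level sets, filters and the way-below relation *)

Lemma complete_glb (X : Poset) (S : X -> Prop) :
  complete_lattice X -> exists m, is_glb S m.
Proof.
  intros hX; destruct (hX (fun z => forall y, S y -> ple z y)) as [m [h1 h2]].
  exists m; split.
  - intros y hy; apply h2; intros z hz; apply hz, hy.
  - intros z hz; apply h1; exact hz.
Qed.

(** [y] is the value at [t] of the left adjoint of [f]: the meet of the level set, which belongs to
    it because [f] preserves meets. *)
Lemma level_min_ex (X : Poset) (f : X -> I) (t : R) :
  complete_lattice X ->
  (forall (S : X -> Prop) m, is_glb S m -> is_glb (image f S) (f m)) ->
  0 <= t <= 1 -> exists y, forall x, ple y x <-> t <= val (f x).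
Proof.
  intros hX hf ht; destruct (exI t ht) as [t' ht'].
  destruct (complete_glb X (fun x => t <= val (f x)) hX) as [y hy].
  exists y; intros x; split.
  - intros h; apply Rle_trans with (val (f y)).
    + rewrite <- ht'; apply val_le, (hf _ _ hy); intros z [w [hw <-]].
      apply Ile; lra.
    + apply val_le, (mono_of_glb f hf), h.
  - intros h; apply hy, h.
Qed.

(** Since [f] preserves [Phi]-joins, a [Phi]-set whose join is above [x] has a member where [f]
    exceeds [s], and [y] is below that member. *)
Lemma way_below_level (Phi : Doctrine) (X : Poset) (f : X -> I) (s : R) (y x : X) :
  complete_lattice X -> ctsmor Phi X I f -> 0 <= s < val (f x) ->
  (forall z, s <= val (f z) -> ple y z) -> way_below Phi X y x.
Proof.
  intros hX hf hs hy phi [hl hphi] hj.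
  destruct (hX phi) as [j hlub].
  assert (h : ple (f x) (f j)) by (apply (mono_of_glb f (proj1 hf)), hj, hlub).
  apply val_le in h.
  destruct (I_lub_gt _ _ s (proj2 hf phi j hphi hlub)) as [w [[z [hz <-]] hlt]];
    [lra|].
  apply (hl y z); auto; apply hy; lra.
Qed.

(** The meet of a [Psi]-small part of the filter stays in the filter because [p] preserves it; in
    the opposite order it is the bound that [doctrine_of_bounded] asks for. *)
Lemma filter_doctrine (Phi Psi : Doctrine) (A : UPoset) (p : HomU Psi A) :
  join_doctrine Phi -> join_doctrine Psi -> sound Phi Psi -> UInf Psi A ->
  Phi (op (sub A (fun a => val (ev a p) = 1))).
Proof.
  intros hPhi hPsi hs (_ & hmeet & _).
  set (F := fun a => val (ev a p) = 1).
  apply (doctrine_of_bounded Phi Psi); auto.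
  intros S hS.
  (* [S] lives in a subposet of [A]; [S'] is the same set regarded inside [A], where the meets
     exist. *)
  set (S' := fun a : A => exists h : F a, S (exist _ a h)).
  assert (hS' : Psi (op (sub A S'))).
  { assert (inc : forall z : sub (op (sub A F)) S, S' (proj1_sig (proj1_sig z))).
    { intros [[a ha] hz]; exists ha; exact hz. }
    pose proof hPsi as (_ & _ & h3 & _).
    apply (h3 (sub (op (sub A F)) S) (op (sub A S'))
             (fun z => exist _ (proj1_sig (proj1_sig z)) (inc z))); auto.
    - intros z z' h; exact h.
    - intros [a [ha hz]].
      exists (exist _ a (inc (exist _ (exist _ a ha) hz))); split.
      + exists (exist _ (exist _ a ha) hz); split; auto; exact Logic.I.
      + apply (ple_refl A). }
  destruct (hmeet S' hS') as [m hm].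
  assert (hmF : F m).
  { destruct (exI 1 ltac:(lra)) as [o ho].
    assert (h : ple o (ev m p)).
    { apply (proj2 (proj2 (ev_umor p)) S' m hS' hm); intros y [a [[ha _] <-]].
      apply Ile; unfold F in ha; lra. }
    apply val_le in h; pose proof (val_bounds (ev m p)); unfold F; lra. }
  exists (exist _ m hmF); intros [a ha] hz; apply (proj1 hm a); exists ha; exact hz.
Qed.

(* For [X] continuous and [E f x = f x], the join of this set is the point of
   [X] represented by [p]. *)
Definition approximants {Psi : Doctrine} {A : UPoset} {X : Poset}
  (E : A -> X -> I) (p : HomU Psi A) : X -> Prop :=
  fun y => exists a, val (ev a p) = 1 /\ forall z, 1 / 2 <= val (E a z) -> ple y z.

(** The least points [g a] of the level sets, for [a] in the filter [p a = 1], are cofinal among the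
    approximants, and [g] reverses order. Any level strictly between 0 and 1 could replace 1/2. *)
Lemma approximants_PhiL (Phi Psi : Doctrine) (A : UPoset) (X : Poset)
  (E : A -> X -> I) (p : HomU Psi A) :
  join_doctrine Phi -> join_doctrine Psi -> sound Phi Psi -> UInf Psi A ->
  complete_lattice X ->
  (forall a (S : X -> Prop) m, is_glb S m -> is_glb (image (E a) S) (E a m)) ->
  (forall a b z, ple a b -> val (E a z) <= val (E b z)) ->
  PhiL Phi X (approximants E p).
Proof.
  intros hPhi hPsi hs hA hX hE hmon; split.
  { intros x y h [a [ha hy]]; exists a; split; auto.
    intros z hz; eapply ple_trans; eauto. }
  assert (hg : forall a, exists y, forall x, ple y x <-> 1 / 2 <= val (E a x)).
  { intros a; apply level_min_ex; auto; lra. }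
  pose (g := fun a => proj1_sig (constructive_indefinite_description _ (hg a))).
  assert (hg' : forall a x, ple (g a) x <-> 1 / 2 <= val (E a x)).
  { intros a; unfold g; destruct constructive_indefinite_description; auto. }
  apply (doctrine_sub Phi (op (sub A (fun a => val (ev a p) = 1))) X
           (fun a => g (proj1_sig a))); auto.
  - apply (filter_doctrine Phi Psi); auto.
  - intros [a ha] [b hb] h; simpl in *; apply hg'.
    apply Rle_trans with (val (E b (g b))); [apply hg', ple_refl|apply hmon, h].
  - intros [a ha]; exists a; split; auto; intros z hz; apply hg', hz.
  - intros y [a [ha hy]]; exists (exist _ a ha); apply hy, hg', ple_refl.
Qed.

(** A ramp from [E a j] to [p a] moves [a] into the filter while making its value at [j] zero; but
    its least point of level 1/2 is an approximant, hence below [j]. *)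
Lemma approximants_lub_ge (Psi : Doctrine) (A : UPoset) (X : Poset)
  (E : A -> X -> I) (p : HomU Psi A) (j : X) (a : A) :
  complete_lattice X ->
  (forall a (S : X -> Prop) m, is_glb S m -> is_glb (image (E a) S) (E a m)) ->
  (forall u a z, E (act u a) z = app u (E a z)) ->
  is_lub (approximants E p) j -> val (ev a p) <= val (E a j).
Proof.
  intros hX hE hact [hj _]; apply Rnot_lt_le; intros hlt.
  pose proof (val_bounds (ev a p)); pose proof (val_bounds (E a j)).
  set (u := ramp (val (E a j)) (val (ev a p))).
  destruct (level_min_ex X (E (act u a)) (1 / 2)) as [y hy]; auto; [lra|].
  assert (h : ple y j).
  { apply hj; exists (act u a); split.
    - rewrite ev_act; apply ramp_hi; lra.
    - intros z hz; apply hy, hz. }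
  apply hy in h; rewrite hact in h; unfold u in h; rewrite ramp_lo in h; lra.
Qed.

Lemma HomU_cts (Phi Psi : Doctrine) (A : UPoset) :
  join_doctrine Phi -> join_doctrine Psi -> sound Phi Psi -> UInf Psi A ->
  cts_lattice Phi (HomU Psi A).
Proof.
  intros hPhi hPsi hs hA; split; [apply HomU_complete|].
  intros p; exists (approximants ev p); split; [|split].
  - apply (approximants_PhiL Phi Psi); auto.
    + apply HomU_complete.
    + intros a S m; apply ev_glb.
    + intros a b q h; apply ev_mono, h.
  - intros q [a [ha hq]].
    apply (way_below_level Phi (HomU Psi A) (ev a) (1 / 2)); auto.
    + apply HomU_complete.
    + apply ev_ctsmor; auto.
    + lra.
  - intros j hj a; apply Ile.
    apply (approximants_lub_ge Psi A (HomU Psi A) ev p j a); auto.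
    + apply HomU_complete.
    + intros b S m; apply ev_glb.
    + intros u b q; apply ev_act.
Qed.

(** The point is the join [j] of the approximants. If [f j] exceeded [p f], then for [s] in between
    the least point [y] with [f >= s] would be way below [j], hence itself an approximant, with a
    witness [f']. *)
Lemma HomU_HomC_point (Phi Psi : Doctrine) (X : Poset) (p : HomU Psi (HomC Phi X)) :
  join_doctrine Phi -> join_doctrine Psi -> sound Phi Psi -> cts_lattice Phi X ->
  exists x, forall f, evC x f = ev f p.
Proof.
  intros hPhi hPsi hs [hX _].
  set (E := fun (f : HomC Phi X) x => evC x f).
  assert (hEg : forall f (S : X -> Prop) m, is_glb S m ->
             is_glb (image (E f) S) (E f m)).
  { intros f S m; apply (proj1 (evC_ctsmor f)). }
  assert (hL : PhiL Phi X (approximants E p)).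
  { apply (approximants_PhiL Phi Psi); auto; [apply HomC_UInf; auto|].
    intros f g x h; apply val_le, (h x). }
  destruct (hX (approximants E p)) as [j hj]; exists j; intros f; apply val_inj.
  apply Rle_antisym.
  - apply Rnot_lt_le; intros hlt; destruct (Rlt_between _ _ hlt) as [s hs'].
    pose proof (val_bounds (ev f p)); pose proof (val_bounds (evC j f)).
    destruct (level_min_ex X (E f) s) as [y hy]; auto; [lra|].
    assert (hw : way_below Phi X y j).
    { apply (way_below_level Phi X (E f) s); auto.
      - apply evC_ctsmor.
      - unfold E; lra.
      - intros z hz; apply hy, hz. }
    destruct (hw _ hL) as [f' [hf' hf'y]].
    { intros j' hj'; rewrite (lub_unique _ _ _ hj' hj); apply ple_refl. }
    (* Where [f'] is at least 1/2 the point is above [y], so [f] is at least [s]. Applying [p] to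
       this inequality gives [1 <= 0]. *)
    assert (hle : ple (act (ramp (1 / 2) 1) f') (act (ramp (val (ev f p)) s) f)).
    { intros z; apply Ile.
      change (val (app (ramp (1 / 2) 1) (evC z f')) <=
              val (app (ramp (val (ev f p)) s) (evC z f))).
      destruct (Rle_dec (1 / 2) (val (evC z f'))) as [hz|hz].
      - rewrite (ramp_hi (val (ev f p)) s); try lra; [apply val_bounds|].
        apply hy, hf'y, hz.
      - rewrite ramp_lo; try lra; apply val_bounds. }
    apply (ev_mono p) in hle; rewrite !ev_act, ramp_hi, ramp_lo in hle by lra; lra.
  - apply (approximants_lub_ge Psi (HomC Phi X) X E p j f); auto.
Qed.

(** * Interpolation and Urysohn functions on continuous lattices *)

Lemma way_below_le (Phi : Doctrine) (X : Poset) (y x : X) :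
  join_doctrine Phi -> way_below Phi X y x -> ple y x.
Proof.
  intros hPhi h; apply (h (fun z => ple z x)); [apply doctrine_principal; auto|].
  intros j [hj _]; apply hj, ple_refl.
Qed.

Lemma way_below_mono (Phi : Doctrine) (X : Poset) (y y' x x' : X) :
  ple y y' -> way_below Phi X y' x' -> ple x' x -> way_below Phi X y x.
Proof.
  intros h1 h h2 phi hphi hj; apply (proj1 hphi y y' h1), h; auto.
  intros j hlub; eapply ple_trans; eauto.
Qed.

Lemma way_below_PhiL (Phi : Doctrine) (X : Poset) (x : X) :
  join_doctrine Phi -> cts_lattice Phi X ->
  PhiL Phi X (fun y => way_below Phi X y x) /\
  is_lub (fun y => way_below Phi X y x) x.
Proof.
  intros hPhi [hX hc]; destruct (hc x) as [phi [h1 [h2 h3]]].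
  assert (e : (fun y => way_below Phi X y x) = phi).
  { apply functional_extensionality; intros y; apply propositional_extensionality.
    split; auto; intros h; apply h; auto. }
  rewrite e; split; [exact h1|split].
  - intros y hy; apply (way_below_le Phi); auto.
  - intros z hz; destruct (hX phi) as [j hj].
    apply ple_trans with j; auto; apply hj; exact hz.
Qed.

(** The points that can be interpolated below [x] form a lower set in [Phi], as the union of the
    way-below sets of the [z] way below [x]. Its join is above [x], so it contains [y]. *)
Lemma interpolation (Phi : Doctrine) (X : Poset) (y x : X) :
  join_doctrine Phi -> cts_lattice Phi X -> way_below Phi X y x ->
  exists z, way_below Phi X y z /\ way_below Phi X z x.
Proof.
  intros hPhi hX h.
  set (psi := fun y => exists z, way_below Phi X y z /\ way_below Phi X z x).
  apply (h psi).
  - split.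
    { intros a b hab [z [h1 h2]]; exists z; split; auto.
      eapply way_below_mono; eauto; apply ple_refl. }
    set (TD := fun z (w : sub X psi) => way_below Phi X (proj1_sig w) z).
    pose proof hPhi as (_ & hun & _ & _).
    apply (hun (sub X psi) (fun T => exists z, way_below Phi X z x /\ T = TD z)).
    + intros T [z [hz ->]].
      assert (inc : forall w : sub X (fun w => way_below Phi X w z), psi (proj1_sig w)).
      { intros [w hw]; exists z; auto. }
      apply (doctrine_sub Phi (sub X (fun w => way_below Phi X w z)) (sub X psi)
               (fun w => exist _ (proj1_sig w) (inc w))); auto.
      * apply way_below_PhiL; auto.
      * intros w w' hw; exact hw.
      * intros [w hw]; exact hw.
      * intros [w hw] hT; exists (exist _ w hT); apply (ple_refl X).
    + apply (doctrine_sub Phi (sub X (fun z => way_below Phi X z x))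
               (powerset (sub X psi)) (fun z => TD (proj1_sig z))); auto.
      * apply way_below_PhiL; auto.
      * intros [z hz] [z' hz'] hzz w hw.
        exact (way_below_mono Phi X _ _ _ _ (ple_refl _ _) hw hzz).
      * intros [z hz]; exists z; auto.
      * intros T [z [hz ->]]; exists (exist _ z hz).
        apply (ple_refl (powerset (sub X psi))).
    + intros [w [z [h1 h2]]]; exists (TD z); split; [exists z; auto|exact h1].
  - intros j [hj _].
    apply (way_below_PhiL Phi X x hPhi hX); intros z hz.
    apply (way_below_PhiL Phi X z hPhi hX); intros w hw.
    apply hj; exists z; auto.
Qed.

(** [f x] is the supremum of the labels of points below [x]. Labels are a relation because a dyadic
    number has many representations. *)
Lemma level_function (Phi : Doctrine) (X : Poset) (W : R -> X -> Prop) :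
  join_doctrine Phi -> complete_lattice X ->
  (forall q y, W q y -> 0 <= q <= 1) ->
  (forall q y q' y', W q y -> W q' y' -> q < q' -> way_below Phi X y y') ->
  (forall c c', 0 <= c < c' -> c' <= 1 -> exists q y, c < q < c' /\ W q y) ->
  exists f : X -> I, ctsmor Phi X I f /\
    (forall q y x, W q y -> ple y x -> q <= val (f x)) /\
    (forall c x, 0 <= c < val (f x) -> exists q y, c < q /\ W q y /\ ple y x).
Proof.
  intros hPhi hX hb hw hd.
  set (L := fun x (t : I) => exists y, W (val t) y /\ ple y x).
  exists (fun x => Isup (L x)).
  assert (h1 : forall q y x, W q y -> ple y x -> q <= val (Isup (L x))).
  { intros q y x hq hy; destruct (exI q (hb q y hq)) as [t ht].
    rewrite <- ht; apply val_le, (Isup_lub (L x)); exists y; rewrite ht; auto. }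
  assert (h2 : forall c x, 0 <= c < val (Isup (L x)) ->
             exists q y, c < q /\ W q y /\ ple y x).
  { intros c x hc; destruct (I_lub_gt _ _ c (Isup_lub (L x)) hc) as [t [[y [hy hyx]] ht]].
    exists (val t), y; auto. }
  assert (hmon : forall x y, ple x y -> ple (Isup (L x)) (Isup (L y))).
  { intros x y hxy; apply (Isup_lub (L x)); intros t [w [hw1 hw2]].
    apply (Isup_lub (L y)); exists w; split; auto; eapply ple_trans; eauto. }
  split; [split|split; auto].
  - intros S m hm; split.
    { intros y [x [hx <-]]; apply hmon, hm, hx. }
    intros z hz; apply Ile, Rnot_lt_le; intros hlt.
    pose proof (val_bounds z); pose proof (val_bounds (Isup (L m))).
    (* A point labelled strictly inside the gap lies below every element of [S], hence below [m], so
       its label bounds [f m] from below. *)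
    destruct (hd _ _ (conj (proj1 H0) hlt)) as [q [y [hq hy]]]; [lra|].
    assert (hym : ple y m).
    { apply hm; intros x hx.
      assert (hzx : val z <= val (Isup (L x))) by (apply val_le, hz; exists x; auto).
      destruct (h2 q x) as [q' [y' [hq' [hy' hyx]]]]; [lra|].
      apply ple_trans with y'; auto.
      apply (way_below_le Phi); auto; apply (hw q y q' y'); auto. }
    pose proof (h1 q y m hy hym); lra.
  - intros S m hS hm; split.
    { intros y [x [hx <-]]; apply hmon, hm, hx. }
    intros z hz; apply Ile, Rnot_lt_le; intros hlt.
    pose proof (val_bounds z); pose proof (val_bounds (Isup (L m))).
    destruct (h2 (val z) m) as [q [y [hq [hy hym]]]]; [lra|].
    destruct (hd (val z) q) as [q' [y' [hq' hy']]]; [lra|apply hb in hy; lra|].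
    (* [y'] is way below [y], which is below the join [m]; the relation is applied to the lower
       closure of [S]. *)
    assert (hin : exists x, S x /\ ple y' x).
    { apply (hw q' y' q y hy' hy ltac:(lra) (fun a => exists b, S b /\ ple a b)).
      - apply doctrine_down; auto.
      - intros j [hj _]; apply ple_trans with m; auto; apply hm.
        intros x hx; apply hj; exists x; split; auto; apply ple_refl. }
    destruct hin as [x [hx hyx]].
    assert (hzx : val (Isup (L x)) <= val z) by (apply val_le, hz; exists x; auto).
    pose proof (h1 q' y' x hy' hyx); lra.
Qed.

(** The point placed at [k / 2^n] on a chain from [z] to [x]: even indices keep the points of the
    previous level, odd ones interpolate with [i]. Indices above [2^n] give junk. *)
Fixpoint dyadic {X : Type} (i : X -> X -> X) (z x : X) (n : nat) : nat -> X :=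
  match n with
  | O => fun k => match k with O => z | S _ => x end
  | S n => fun k =>
      if Nat.even k then dyadic i z x n (Nat.div2 k)
      else i (dyadic i z x n (Nat.div2 k)) (dyadic i z x n (S (Nat.div2 k)))
  end.

Lemma dyadic_even {X : Type} (i : X -> X -> X) z x n k :
  dyadic i z x (S n) (2 * k) = dyadic i z x n k.
Proof.
  cbn [dyadic]; rewrite Nat.even_mul; cbn [Nat.even orb].
  rewrite Nat.div2_double; reflexivity.
Qed.

Lemma dyadic_odd {X : Type} (i : X -> X -> X) z x n k :
  dyadic i z x (S n) (S (2 * k)) = i (dyadic i z x n k) (dyadic i z x n (S k)).
Proof.
  cbn [dyadic]; rewrite Nat.even_succ, Nat.odd_mul; cbn [Nat.odd Nat.even negb andb].
  rewrite Nat.div2_succ_double; reflexivity.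
Qed.

Lemma dyadic_lift {X : Type} (i : X -> X -> X) z x n m k :
  dyadic i z x (m + n) (2 ^ m * k) = dyadic i z x n k.
Proof.
  induction m as [|m IH].
  - simpl; f_equal; lia.
  - rewrite Nat.pow_succ_r', <- Nat.mul_assoc; simpl plus.
    rewrite dyadic_even; exact IH.
Qed.

Lemma dyadic_dense (c c' : R) : 0 <= c < c' -> c' <= 1 ->
  exists n k, (k <= 2 ^ n)%nat /\ c < INR k / 2 ^ n < c'.
Proof.
  intros h1 h2.
  destruct (pow_lt_1_zero (1 / 2) ltac:(rewrite Rabs_right; lra) (c' - c) ltac:(lra))
    as [n hn].
  specialize (hn n (le_n n)).
  assert (hp : 0 < 2 ^ n) by (apply pow_lt; lra).
  assert (he : (1 / 2) ^ n * 2 ^ n = 1)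
    by (rewrite <- Rpow_mult_distr; replace (1 / 2 * 2) with 1 by lra; apply pow1).
  apply Rabs_def2 in hn; destruct hn as [hn _].
  destruct (archimed (c * 2 ^ n)) as [a1 a2].
  assert (hc : 0 <= c * 2 ^ n) by (apply Rmult_le_pos; lra).
  assert (hz : (0 <= Rdefinitions.up (c * 2 ^ n))%Z) by (apply le_IZR; lra).
  destruct (IZN _ hz) as [k hk].
  rewrite hk, <- INR_IZR_INZ in a1, a2.
  assert (hlt : c < INR k / 2 ^ n < c').
  { split; apply (Rmult_lt_reg_r (2 ^ n)); auto;
      replace (INR k / 2 ^ n * 2 ^ n) with (INR k) by (field; lra); try lra.
    apply Rle_lt_trans with (c * 2 ^ n + 1); [lra|].
    assert ((1 / 2) ^ n * 2 ^ n < (c' - c) * 2 ^ n) by (apply Rmult_lt_compat_r; auto).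
    lra. }
  exists n, k; split; auto.
  apply INR_le; rewrite pow_INR; change (INR 2) with 2.
  assert (INR k / 2 ^ n * 2 ^ n = INR k) by (field; lra).
  assert (INR k / 2 ^ n * 2 ^ n <= 1 * 2 ^ n) by (apply Rmult_le_compat_r; lra).
  lra.
Qed.

Lemma urysohn (Phi : Doctrine) (X : Poset) (z x : X) :
  join_doctrine Phi -> cts_lattice Phi X -> way_below Phi X z x ->
  exists f : X -> I, ctsmor Phi X I f /\ val (f x) = 1 /\
    forall y, 0 < val (f y) -> ple z y.
Proof.
  intros hPhi hX hzx.
  (* Stated for all pairs so that choice yields a total [i], as [dyadic] requires. *)
  assert (hi : forall ab : X * X, exists c, way_below Phi X (fst ab) (snd ab) ->
             way_below Phi X (fst ab) c /\ way_below Phi X c (snd ab)).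
  { intros [a b]; simpl; destruct (classic (way_below Phi X a b)) as [h|h].
    - destruct (interpolation Phi X a b hPhi hX h) as [c hc]; exists c; auto.
    - exists a; tauto. }
  pose (i := fun a b =>
    proj1_sig (constructive_indefinite_description _ (hi (a, b)))).
  assert (hi' : forall a b, way_below Phi X a b ->
             way_below Phi X a (i a b) /\ way_below Phi X (i a b) b).
  { intros a b; exact (proj2_sig (constructive_indefinite_description _ (hi (a, b)))). }
  set (d := dyadic i z x).
  assert (hstep : forall n k, (k < 2 ^ n)%nat -> way_below Phi X (d n k) (d n (S k))).
  { induction n as [|n IH]; intros k hk.
    - simpl in hk; replace k with O by lia; exact hzx.
    - rewrite Nat.pow_succ_r' in hk.
      destruct (Nat.Even_or_Odd k) as [[j ->]|[j ->]]; unfold d.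
      + rewrite dyadic_even, dyadic_odd; apply (proj1 (hi' _ _ (IH j ltac:(lia)))).
      + replace (2 * j + 1)%nat with (S (2 * j)) by lia.
        rewrite dyadic_odd; replace (S (S (2 * j))) with (2 * S j)%nat by lia.
        rewrite dyadic_even; apply (proj2 (hi' _ _ (IH j ltac:(lia)))). }
  assert (hlev : forall n k k', (k < k')%nat -> (k' <= 2 ^ n)%nat ->
             way_below Phi X (d n k) (d n k')).
  { intros n k k' h; induction h as [|k' h IH]; intros hk'; [apply hstep; lia|].
    apply (way_below_mono Phi X _ (d n k') _ (d n (S k')));
      [|apply hstep; lia|apply ple_refl].
    apply (way_below_le Phi); auto; apply IH; lia. }
  destruct (level_function Phi X (fun q y => exists n k, (k <= 2 ^ n)%nat /\
              q = INR k / 2 ^ n /\ y = d n k)) as [f [hf [h1 h2]]]; auto.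
  - apply hX.
  - intros q y [n [k [hk [-> _]]]].
    assert (hp : 0 < 2 ^ n) by (apply pow_lt; lra).
    apply le_INR in hk; rewrite pow_INR in hk; change (INR 2) with 2 in hk.
    pose proof (pos_INR k).
    assert (INR k / 2 ^ n * 2 ^ n = INR k) by (field; lra).
    split; apply (Rmult_le_reg_r (2 ^ n)); lra.
  - intros q y q' y' [n [k [hk [-> ->]]]] [n' [k' [hk' [-> ->]]]] hlt.
    (* Both points are read at the common level [n + n'], where comparing labels is comparing
       indices. *)
    unfold d; rewrite <- (dyadic_lift i z x n n' k), <- (dyadic_lift i z x n' n k').
    rewrite (Nat.add_comm n' n); apply hlev.
    + apply INR_lt; rewrite !mult_INR, !pow_INR; change (INR 2) with 2.
      assert (hp : 0 < 2 ^ n) by (apply pow_lt; lra).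
      assert (hp' : 0 < 2 ^ n') by (apply pow_lt; lra).
      assert (e : INR k / 2 ^ n * (2 ^ n * 2 ^ n') = 2 ^ n' * INR k) by (field; lra).
      assert (e' : INR k' / 2 ^ n' * (2 ^ n * 2 ^ n') = 2 ^ n * INR k') by (field; lra).
      rewrite <- e, <- e'; apply Rmult_lt_compat_r; auto.
      apply Rmult_lt_0_compat; auto.
    + rewrite Nat.pow_add_r; apply Nat.mul_le_mono_l; auto.
  - intros c c' hc hc'; destruct (dyadic_dense c c' hc hc') as [n [k [hk hb]]].
    exists (INR k / 2 ^ n), (d n k); split; auto; exists n, k; auto.
  - exists f; split; auto; split.
    + assert (h : 1 <= val (f x)).
      { apply (h1 1 x x); [|apply ple_refl].
        exists O, 1%nat; split; [simpl; lia|]; split; [simpl; field|reflexivity]. }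
      pose proof (val_bounds (f x)); lra.
    + intros y hy; destruct (h2 0 y ltac:(lra)) as [q [w [hq [[n [k [hk [-> ->]]]] hw]]]].
      apply ple_trans with (d n k); auto; apply (way_below_le Phi); auto.
      (* [z] is the point of index 0 at level [n] as well, and [k] is positive because its label
         is. *)
      unfold d; change z with (dyadic i z x 0 0) at 1.
      rewrite <- (dyadic_lift i z x 0 n 0), Nat.mul_0_r, Nat.add_0_r.
      apply hlev; auto.
      destruct k; [|lia]; simpl in hq; unfold Rdiv in hq; lra.
Qed.

(** [x] is the join of the [z] way below it, and the Urysohn function of such a [z] is 1 at [x],
    hence positive at [y]. *)
Lemma HomC_order (Phi : Doctrine) (X : Poset) (x y : X) :
  join_doctrine Phi -> cts_lattice Phi X ->
  (forall f : HomC Phi X, val (evC x f) <= val (evC y f)) -> ple x y.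
Proof.
  intros hPhi hX h; apply (way_below_PhiL Phi X x hPhi hX); intros z hz.
  destruct (urysohn Phi X z x hPhi hX hz) as [f [hf [h1 h2]]].
  apply h2; specialize (h (exist _ f hf)).
  change (val (f x) <= val (f y)) in h; lra.
Qed.

Lemma order_iso_glb (X Y : Poset) (h : X -> Y) (g : Y -> X) (S : X -> Prop) (m : X) :
  (forall x x', ple x x' <-> ple (h x) (h x')) -> (forall y, h (g y) = y) ->
  is_glb S m -> is_glb (image h S) (h m).
Proof.
  intros hh hg [h1 h2]; split.
  - intros y [x [hx <-]]; apply hh, h1, hx.
  - intros z hz; rewrite <- (hg z); apply hh, h2; intros x hx.
    apply hh; rewrite hg; apply hz; exists x; auto.
Qed.

Lemma order_iso_ctsmor (Phi : Doctrine) (X Y : Poset) (h : X -> Y) (g : Y -> X) :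
  (forall x x', ple x x' <-> ple (h x) (h x')) -> (forall y, h (g y) = y) ->
  ctsmor Phi X Y h.
Proof.
  intros hh hg; split.
  - intros S m; apply (order_iso_glb X Y h g); auto.
  - intros S m _; apply (order_iso_glb (op X) (op Y) h g); auto.
    intros x x'; apply hh.
Qed.

(** * Separating points of an inflattice by morphisms to the interval *)

Lemma act_comp (A : UPoset) (u v : Uel) (a : A) :
  is_UPoset A -> act (Ucomp u v) a = act u (act v a).
Proof. intros (_ & h & _); apply h; reflexivity. Qed.

Lemma act_mono (A : UPoset) (u v : Uel) (a b : A) :
  is_UPoset A -> (forall t, val (app u t) <= val (app v t)) -> ple a b ->
  ple (act u a) (act v b).
Proof. intros (_ & _ & h) huv; apply h; exact huv. Qed.

Lemma act_ext (A : UPoset) (u v : Uel) (a : A) :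
  is_UPoset A -> (forall t, val (app u t) = val (app v t)) -> act u a = act v a.
Proof.
  intros hA huv; apply ple_anti; apply act_mono; auto; try apply ple_refl;
    intros t; rewrite huv; lra.
Qed.

Lemma ramp_anti p q p' q' t : 0 <= p <= p' -> p < q -> p' < q' -> q <= q' <= 1 ->
  val (app (ramp p' q') t) <= val (app (ramp p q) t).
Proof.
  intros h1 h2 h3 h4.
  destruct (Rle_dec (val t) p').
  { rewrite ramp_lo; try lra; apply val_bounds. }
  destruct (Rle_dec q (val t)).
  { rewrite (ramp_hi p q); try lra; apply val_bounds. }
  rewrite !ramp_mid by lra.
  apply (Rmult_le_reg_r ((q' - p') * (q - p))); [nra|].
  replace ((val t - p') / (q' - p') * ((q' - p') * (q - p)))
    with ((val t - p') * (q - p)) by (field; lra).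
  replace ((val t - p) / (q - p) * ((q' - p') * (q - p)))
    with ((val t - p) * (q' - p')) by (field; lra).
  set (x := val t) in *.
  (* The cross-multiplied difference is the sum of this product and the next. *)
  assert (0 <= (x - p') * (q' - q)) by nra.
  assert (0 <= (p' - p) * (q' - x)) by nra.
  nra.
Qed.

Lemma ramp_comp p q p' q' t : 0 <= p < q -> q <= 1 -> 0 <= p' < q' -> q' <= 1 ->
  val (app (ramp p' q') (app (ramp p q) t)) =
  val (app (ramp (p + p' * (q - p)) (p + q' * (q - p))) t).
Proof.
  intros h1 h2 h3 h4.
  assert (hP : 0 <= p + p' * (q - p) < p + q' * (q - p)) by nra.
  assert (hQ : p + q' * (q - p) <= 1) by nra.
  set (y := app (ramp p q) t).
  assert (hy : (val t <= p /\ val y = 0) \/ (q <= val t /\ val y = 1) \/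
               (p < val t < q /\ val y * (q - p) = val t - p)).
  { destruct (Rle_dec (val t) p); [left; split; auto; apply ramp_lo; lra|right].
    destruct (Rle_dec q (val t)); [left; split; auto; apply ramp_hi; lra|right].
    split; [lra|]; unfold y; rewrite ramp_mid by lra; field; lra. }
  destruct (Rle_dec (val t) (p + p' * (q - p))) as [c1|c1].
  { rewrite (ramp_lo (p + _)) by lra; apply ramp_lo; try lra.
    destruct hy as [hy|[hy|hy]]; nra. }
  destruct (Rle_dec (p + q' * (q - p)) (val t)) as [c2|c2].
  { rewrite (ramp_hi (p + _)) by lra; apply ramp_hi; try lra.
    destruct hy as [hy|[hy|hy]]; nra. }
  destruct hy as [hy|[hy|[hy1 hy2]]]; [nra|nra|].
  rewrite !ramp_mid; try lra; [|nra].
  assert (e : val y = (val t - p) / (q - p)) by (rewrite <- hy2; field; lra).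
  rewrite e; field; nra.
Qed.

Lemma act_ramp_comp (A : UPoset) (a : A) p q p' q' :
  is_UPoset A -> 0 <= p < q -> q <= 1 -> 0 <= p' < q' -> q' <= 1 ->
  act (ramp p' q') (act (ramp p q) a) =
  act (ramp (p + p' * (q - p)) (p + q' * (q - p))) a.
Proof.
  intros hA h1 h2 h3 h4; rewrite <- act_comp by auto.
  apply act_ext; auto; intros t; rewrite app_comp; apply ramp_comp; auto.
Qed.

Lemma inv_succ_small (e : R) : 0 < e -> exists n, / (INR n + 1) < e.
Proof.
  intros he; destruct (archimed_cor1 e he) as [N [h1 h2]]; exists N.
  apply Rlt_trans with (/ INR N); auto.
  assert (0 < INR N) by (apply lt_0_INR; auto).
  apply Rinv_lt_contravar; nra.
Qed.

Lemma inv_succ_bounds (n : nat) : 0 < / (INR n + 1) <= 1.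
Proof.
  pose proof (pos_INR n); split; [apply Rinv_0_lt_compat; lra|].
  rewrite <- Rinv_1 at 2; apply Rinv_le_contravar; lra.
Qed.

Lemma inv_succ_anti (n m : nat) : (n <= m)%nat -> / (INR m + 1) <= / (INR n + 1).
Proof.
  intros h; apply le_INR in h; pose proof (pos_INR n).
  apply Rinv_le_contravar; lra.
Qed.

(* For some [n], this makes [s < p b] whenever [t <= p a], for all morphisms [p].
   The index [n] makes the union over all witnesses an [omega]-indexed one, which
   commutes with [Psi^op]-meets because [omega] is in [Phi]. *)
Definition level_rel (A : UPoset) (a : A) (t : R) (b : A) (s : R) (n : nat) : Prop :=
  ple (act (ramp (t - t * / (INR n + 1)) t) a)
      (act (ramp s (s + (1 - s) * / (INR n + 1))) b).

(** A larger [n] lowers the ramp on the left and raises the one on the right, as does a smaller [s].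
    Scaling the widths by [t] and [1 - s] keeps all endpoints in [[0,1]] for every [n]. *)
Lemma level_rel_mono (A : UPoset) (a : A) t b b' s s' n n' :
  is_UPoset A -> 0 < t <= 1 -> 0 <= s <= s' -> s' < 1 -> (n <= n')%nat -> ple b b' ->
  level_rel A a t b s' n -> level_rel A a t b' s n'.
Proof.
  intros hA ht hs hs' hn hb h; unfold level_rel in *.
  pose proof (inv_succ_bounds n); pose proof (inv_succ_bounds n').
  apply inv_succ_anti in hn.
  set (i := / (INR n + 1)) in *; set (i' := / (INR n' + 1)) in *.
  eapply ple_trans; [|eapply ple_trans; [exact h|]]; apply act_mono; auto.
  - intros x; apply ramp_anti; nra.
  - apply ple_refl.
  - intros x; apply ramp_anti; nra.
Qed.

(** Arbitrary test maps reduce to steep ramps. After composing with [ramp (1 / 3) (2 / 3)], [u] is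
    already 1 from [t1 < t] on and [v] still 0 up to [s1 > s]; once [1 / (n + 1)] is below both
    margins, the ramps fit. *)
Lemma level_rel_intro (A : UPoset) (a b : A) (u v : Uel) (t s : I) :
  is_UPoset A -> val (app u t) = 1 -> val (app v s) = 0 ->
  ple (act u a) (act v b) -> exists n, level_rel A a (val t) b (val s) n.
Proof.
  intros hA hu hv h.
  destruct (app_surj u (2 / 3) ltac:(lra)) as [t1 ht1].
  destruct (app_surj v (1 / 3) ltac:(lra)) as [s1 hs1].
  assert (h1 : val t1 < val t) by (apply (app_lt_inv u); lra).
  assert (h2 : val s < val s1) by (apply (app_lt_inv v); lra).
  pose proof (val_bounds t); pose proof (val_bounds s); pose proof (val_bounds t1).
  pose proof (val_bounds s1).
  destruct (inv_succ_small (Rmin (val t - val t1) (val s1 - val s))) as [n hn].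
  { apply Rmin_glb_lt; lra. }
  assert (hn1 : / (INR n + 1) < val t - val t1)
    by (eapply Rlt_le_trans; [exact hn|apply Rmin_l]).
  assert (hn2 : / (INR n + 1) < val s1 - val s)
    by (eapply Rlt_le_trans; [exact hn|apply Rmin_r]).
  pose proof (inv_succ_bounds n).
  exists n; unfold level_rel; set (i := / (INR n + 1)) in *.
  set (w := ramp (1 / 3) (2 / 3)).
  apply ple_trans with (act w (act u a)); [|apply ple_trans with (act w (act v b))].
  - rewrite <- act_comp by auto; apply act_mono; auto; [|apply ple_refl].
    intros x; rewrite app_comp.
    destruct (Rle_dec (val x) (val t - val t * i)) as [c|c].
    + rewrite ramp_lo by nra; apply val_bounds.
    + unfold w; rewrite (ramp_hi (1 / 3)); try lra; [apply val_bounds|].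
      rewrite <- ht1; apply app_mono; nra.
  - apply act_mono; auto; intros x; lra.
  - rewrite <- act_comp by auto; apply act_mono; auto; [|apply ple_refl].
    intros x; rewrite app_comp.
    destruct (Rle_dec (val x) (val s + (1 - val s) * i)) as [c|c].
    + unfold w; rewrite (ramp_lo (1 / 3)); try lra; [apply val_bounds|].
      rewrite <- hs1; apply app_mono; nra.
    + rewrite (ramp_hi (val s)) by nra; apply val_bounds.
Qed.

(* The least morphism taking a value at least [t] at [a]. *)
Definition least_at (A : UPoset) (a : A) (t : R) (b : A) : I :=
  Isup (fun s => val s < 1 /\ exists n, level_rel A a t b (val s) n).

Lemma least_at_ge (A : UPoset) (a : A) t b s n :
  0 <= s < 1 -> level_rel A a t b s n -> s <= val (least_at A a t b).
Proof.
  intros hs h; destruct (exI s ltac:(lra)) as [s' hs'].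
  rewrite <- hs'; apply val_le, Isup_lub; rewrite hs'; split; [lra|eauto].
Qed.

Lemma least_at_gt (A : UPoset) (a : A) t b s :
  is_UPoset A -> 0 < t <= 1 -> 0 <= s < val (least_at A a t b) ->
  exists n, level_rel A a t b s n.
Proof.
  intros hA ht hs.
  destruct (I_lub_gt _ _ s (Isup_lub _) hs) as [s' [[h1 [n hn]] h2]].
  exists n; eapply level_rel_mono; eauto; try lra; apply ple_refl.
Qed.

Lemma least_at_umor (Phi Psi : Doctrine) (A : UPoset) (a : A) (t : R) :
  join_doctrine Phi -> join_doctrine Psi -> sound Phi Psi -> Phi natP ->
  UInf Psi A -> 0 < t <= 1 -> umor Psi A IU (least_at A a t).
Proof.
  intros hPhi hPsi hs hnat [hA [hmeet hact]] ht.
  destruct (exI t ltac:(lra)) as [t' ht'].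
  assert (hmon : monotone (least_at A a t : A -> I)).
  { intros b b' hb; apply Ile, Rnot_lt_le; intros hlt.
    destruct (Rlt_between _ _ hlt) as [c hc].
    pose proof (val_bounds (least_at A a t b)).
    pose proof (val_bounds (least_at A a t b')).
    destruct (least_at_gt A a t b c) as [n hn]; auto; [lra|].
    assert (h' : level_rel A a t b' c n)
      by (eapply level_rel_mono; eauto; lra).
    apply least_at_ge in h'; lra. }
  split; [exact hmon|split].
  - intros w b.
    change (least_at A a t (act w b) = app w (least_at A a t b)).
    pose proof (val_bounds (least_at A a t b)).
    pose proof (val_bounds (least_at A a t (act w b))).
    pose proof (val_bounds (app w (least_at A a t b))).
    apply val_inj, Rle_antisym; apply Rnot_lt_le; intros hlt;
      destruct (Rlt_between _ _ hlt) as [c hc].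
    + destruct (least_at_gt A a t (act w b) c) as [n hn]; auto; [lra|].
      (* [c] is pulled back along [w], because a ramp from [c] composed with [w] vanishes at [s]. *)
      destruct (app_surj w c ltac:(lra)) as [s hsc].
      assert (hlt' : val (least_at A a t b) < val s)
        by (apply (app_lt_inv w); lra).
      unfold level_rel in hn; rewrite <- act_comp in hn by auto.
      pose proof (inv_succ_bounds n).
      apply (level_rel_intro A a b _ _ t' s) in hn; auto.
      * destruct hn as [m hm]; rewrite ht' in hm; apply least_at_ge in hm; [lra|].
        split; [apply val_bounds|].
        apply Rnot_le_lt; intros hge; pose proof (val_bounds s).
        assert (val (app w s) = 1) by (apply app1; lra); lra.
      * apply ramp_hi; nra.
      * rewrite app_comp; apply ramp_lo; nra.
    + destruct (Rlt_between _ _ (proj1 hc)) as [e he].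
      destruct (app_surj w c ltac:(lra)) as [s hsc].
      assert (hlt' : val s < val (least_at A a t b))
        by (apply (app_lt_inv w); lra).
      pose proof (val_bounds s).
      destruct (least_at_gt A a t b (val s)) as [n hn]; auto; [lra|].
      pose proof (inv_succ_bounds n).
      destruct (exI e ltac:(lra)) as [e' he'].
      destruct (level_rel_intro A a (act w b)
                  (ramp (t - t * / (INR n + 1)) t) (ramp e c) t' e') as [m hm]; auto.
      * apply ramp_hi; nra.
      * apply ramp_lo; lra.
      * eapply ple_trans; [exact hn|].
        rewrite <- act_comp by auto; apply act_mono; auto; [|apply ple_refl].
        intros x; rewrite app_comp.
        destruct (Rle_dec (val x) (val s)) as [hx|hx].
        -- rewrite ramp_lo by nra; apply val_bounds.
        -- rewrite (ramp_hi e c); try lra; [apply val_bounds|].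
           rewrite <- hsc; apply app_mono; lra.
      * rewrite ht', he' in hm; apply least_at_ge in hm; lra.
  - intros S m hS hm; split.
    { intros y [b [hb <-]]; apply hmon, hm, hb. }
    intros z hz; apply Ile, Rnot_lt_le; intros hlt.
    destruct (Rlt_between _ _ hlt) as [c hc].
    pose proof (val_bounds z); pose proof (val_bounds (least_at A a t m)).
    (* One index [n] then serves every [b] in [S], and the action preserves their meet. *)
    destruct (interchange Phi Psi (op (sub A S)) natP
      (fun b n => level_rel A a t (proj1_sig b) c n)) as [n hn]; auto.
    + intros [b hb] [b' hb'] n n' h1 h2 h; simpl in *.
      eapply level_rel_mono; eauto; lra.
    + intros [b hb]; simpl.
      assert (hzb : val z <= val (least_at A a t b))
        by (apply val_le, hz; exists b; auto).
      apply least_at_gt; auto; lra.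
    + assert (h : level_rel A a t m c n).
      { apply (hact _ S m hS hm); intros y [b [hb <-]].
        exact (hn (exist _ b hb)). }
      apply least_at_ge in h; lra.
Qed.

(** The hypothesis is tested on the morphism [least_at A a t], whose value at [a] is at least any
    [c < t], hence exceeds [s] at [b]. *)
Lemma HomU_level_rel (Phi Psi : Doctrine) (A : UPoset) (a b : A) (t s : R) :
  join_doctrine Phi -> join_doctrine Psi -> sound Phi Psi -> Phi natP ->
  UInf Psi A -> (forall p : HomU Psi A, val (ev a p) <= val (ev b p)) ->
  0 <= s < t -> t <= 1 -> exists n, level_rel A a t b s n.
Proof.
  intros hPhi hPsi hs hnat hA h hst ht.
  assert (hU : is_UPoset A) by apply hA.
  apply least_at_gt; auto; [lra|]; split; [lra|].
  destruct (Rlt_between s t) as [c hc]; [lra|].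
  destruct (Rlt_between c t) as [d hd]; [lra|].
  apply Rlt_le_trans with c; [lra|].
  apply Rle_trans with (val (least_at A a t a)).
  - destruct (exI t ltac:(lra)) as [t' ht']; destruct (exI c ltac:(lra)) as [c' hc'].
    destruct (level_rel_intro A a a (ramp d t) (ramp c d) t' c') as [n hn]; auto.
    + apply ramp_hi; lra.
    + apply ramp_lo; lra.
    + apply act_mono; auto; [|apply ple_refl].
      intros x; apply ramp_anti; lra.
    + rewrite ht', hc' in hn; apply least_at_ge in hn; lra.
  - assert (hu : umor Psi A IU (least_at A a t))
      by (apply (least_at_umor Phi); auto; lra).
    exact (h (exist _ (least_at A a t) hu)).
Qed.

(** By induction the comparison holds on [[0, r k]], and unstackability glues on the next slice. *)
Lemma slicing (A : UPoset) (a b : A) (r : nat -> R) (n : nat) :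
  is_UPoset A -> unstackable A -> r O = 0 -> r n = 1 ->
  (forall k, r k <= r (S k)) ->
  (forall k, (k < n)%nat -> r k < r (S k) ->
     ple (act (ramp (r k) (r (S k))) a) (act (ramp (r k) (r (S k))) b)) ->
  ple a b.
Proof.
  intros hA hun h0 hn hmon hsl.
  assert (hpos : forall k, 0 <= r k).
  { induction k as [|k IH]; [lra|]; pose proof (hmon k); lra. }
  assert (hle : forall k m, (k <= m)%nat -> r k <= r m).
  { intros k m hk; induction hk as [|m hk IH]; [lra|]; pose proof (hmon m); lra. }
  assert (H : forall k, (k <= n)%nat -> 0 < r k ->
             ple (act (ramp 0 (r k)) a) (act (ramp 0 (r k)) b)).
  { induction k as [|k IH]; intros hk hr; [lra|].
    pose proof (hmon k) as hm; pose proof (hpos k) as hp.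
    pose proof (hle _ _ hk) as h1; rewrite hn in h1.
    destruct (Req_dec (r k) (r (S k))) as [e|e].
    { rewrite <- e; apply IH; lia || lra. }
    assert (hs := hsl k ltac:(lia) ltac:(lra)).
    destruct (Req_dec (r k) 0) as [e0|e0]; [rewrite e0 in hs; exact hs|].
    (* The position of the cut [r k] after [[0, r (S k)]] has been rescaled to the unit interval. *)
    set (c := r k / r (S k)).
    assert (hc : c * r (S k) = r k) by (unfold c; field; lra).
    assert (hc01 : 0 < c < 1) by nra.
    apply (hun c (ramp 0 c) (ramp c 1)); auto.
    - apply ramp_iso_lo; auto.
    - apply ramp_iso_hi; auto.
    - rewrite !act_ramp_comp by (auto; lra).
      replace (0 + 0 * (r (S k) - 0)) with 0 by ring.
      replace (0 + c * (r (S k) - 0)) with (r k) by lra.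
      apply IH; lia || lra.
    - rewrite !act_ramp_comp by (auto; lra).
      replace (0 + c * (r (S k) - 0)) with (r k) by lra.
      replace (0 + 1 * (r (S k) - 0)) with (r (S k)) by ring.
      exact hs. }
  specialize (H n (le_n n)); rewrite hn in H; specialize (H ltac:(lra)).
  assert (hid : forall c : A, act (ramp 0 1) c = c).
  { intros c; apply hA; intros x; apply val_inj.
    change (val (app (ramp 0 1) x) = val x); pose proof (val_bounds x).
    rewrite ramp_mid by lra; field. }
  rewrite !hid in H; exact H.
Qed.

(** Clamping makes the cut points below monotone at every index, also beyond the last one, as
    [slicing] requires. *)
Definition clampI (x : R) : I := mkI (rampR 0 1 x) (rampR_bounds 0 1 x).

Lemma val_clampI (x : R) : 0 <= x <= 1 -> val (clampI x) = x.
Proof.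
  intros h; change (rampR 0 1 x = x).
  destruct (rampR_cases 0 1 x) as [e|[e|e]]; lra.
Qed.

Lemma clampI_mono (x y : R) : x <= y -> val (clampI x) <= val (clampI y).
Proof.
  intros h; change (rampR 0 1 x <= rampR 0 1 y).
  destruct (rampR_cases 0 1 x) as [e|[e|e]], (rampR_cases 0 1 y) as [e'|[e'|e']]; lra.
Qed.

(* The chain of cut points is pulled back along [u], so that flat pieces of [u]
   produce no slice at all. *)
Lemma HomU_order (Phi Psi : Doctrine) (A : UPoset) (a b : A) :
  join_doctrine Phi -> join_doctrine Psi -> sound Phi Psi -> Phi natP ->
  UInf Psi A -> archimedean A -> unstackable A ->
  (forall p : HomU Psi A, val (ev a p) <= val (ev b p)) -> ple a b.
Proof.
  intros hPhi hPsi hs hnat hA harch hun h.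
  assert (hU : is_UPoset A) by apply hA.
  apply harch; intros r hr u v huv; change (0 < val r) in hr.
  assert (huv' : forall x y, val x <= val y + val r ->
             val (app u x) <= val (app v y)).
  { intros x y hxy; apply Rle_trans with (val (app u (tplus y r))).
    - apply app_mono; rewrite val_tplus; apply Rmin_glb; auto; apply val_bounds.
    - exact (huv y). }
  (* Two grid steps must fit into [r]: one for the slice itself and one for the strict gap demanded
     by [level_rel]. *)
  destruct (inv_succ_small (val r / 2)) as [n hn]; [lra|].
  pose proof (inv_succ_bounds n) as hi.
  assert (hin : (INR n + 1) * / (INR n + 1) = 1)
    by (apply Rinv_r; pose proof (pos_INR n); lra).
  set (i := / (INR n + 1)) in *.
  set (pt := fun k => clampI (INR k * i)).
  assert (hpt : forall k, (k <= S n)%nat -> val (pt k) = INR k * i).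
  { intros k hk; apply val_clampI; pose proof (pos_INR k).
    apply le_INR in hk; rewrite S_INR in hk; split; nra. }
  apply (slicing A _ _ (fun k => val (app u (pt k))) (S n)); auto.
  - apply app0; rewrite hpt by lia; simpl; lra.
  - apply app1; rewrite hpt by lia; rewrite S_INR; exact hin.
  - intros k; apply app_mono, clampI_mono; rewrite S_INR; nra.
  - intros k hk hlt.
    (* The first slice is empty: [u] at the first grid point is at most [v] at 0, which is 0. *)
    destruct k as [|k].
    { exfalso.
      assert (h0 : val (app u (pt 1%nat)) <= val (app v (pt 0%nat))).
      { apply huv'; rewrite !hpt by lia; simpl; lra. }
      rewrite (app0 v) in h0 by (rewrite hpt by lia; simpl; lra).
      pose proof (val_bounds (app u (pt 0%nat))); lra. }
    (* The sliced [u] vanishes up to [pt (S k)], and the sliced [v] is 1 from [pt k] on, so the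
       level relation between these points fits between the two. *)
    destruct (HomU_level_rel Phi Psi A a b (val (pt (S k))) (val (pt k)))
      as [m hm]; auto.
    { rewrite !hpt by lia; rewrite S_INR; pose proof (pos_INR k); nra. }
    { apply val_bounds. }
    unfold level_rel in hm; pose proof (inv_succ_bounds m) as hj.
    set (j := / (INR m + 1)) in *.
    pose proof (val_bounds (app u (pt (S k)))).
    pose proof (val_bounds (app u (pt (S (S k))))).
    assert (hv : val (app u (pt (S (S k)))) <= val (app v (pt k))).
    { apply huv'; rewrite !hpt by lia; rewrite !S_INR; lra. }
    assert (hs1 : 0 < val (pt (S k)) <= 1).
    { split; [|apply val_bounds].
      rewrite hpt by lia; rewrite S_INR; pose proof (pos_INR k); nra. }
    assert (hs0 : 0 <= val (pt k) < 1).
    { split; [apply val_bounds|].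
      rewrite hpt by lia; apply lt_INR in hk; rewrite !S_INR in hk; nra. }
    rewrite <- !act_comp by auto.
    eapply ple_trans; [|eapply ple_trans; [exact hm|]];
      (apply act_mono; [auto| |apply ple_refl]); intros x; rewrite app_comp.
    + destruct (Rle_dec (val x) (val (pt (S k)))) as [hx|hx].
      * rewrite ramp_lo; [apply val_bounds|lra|lra|apply app_mono, hx].
      * rewrite (ramp_hi _ (val (pt (S k)))) by nra; apply val_bounds.
    + destruct (Rle_dec (val x) (val (pt k))) as [hx|hx].
      * rewrite ramp_lo by nra; apply val_bounds.
      * rewrite (ramp_hi (val (app u _))); [apply val_bounds|lra|lra|].
        apply Rle_trans with (1 := hv); apply app_mono; lra.
Qed.

Lemma HomU_separating (Phi Psi : Doctrine) (A : UPoset) :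
  join_doctrine Phi -> join_doctrine Psi -> sound Phi Psi -> Phi natP ->
  UInf Psi A -> archimedean A -> unstackable A ->
  separating A (HomU Psi A) (fun p a => ev a p).
Proof.
  intros; split; [intros p u a; apply ev_act|].
  intros a b; split; [intros h p; apply ev_mono, h|apply (HomU_order Phi); auto].
Qed.

(** * Approximating continuous morphisms by elements *)

(** The least morphisms [x] with [f >= s] and [y] with [f >= t] satisfy [x] way below [y], so [x] is
    an approximant of [y]. The witness [a] has [y a = 1], and [p a >= 1/2] forces [x <= p]; a ramp
    from 1/2 to 1 makes it the separator. *)
Lemma separator (Phi Psi : Doctrine) (A : UPoset) (f : HomU Psi A -> I) (s t : R) :
  join_doctrine Phi -> join_doctrine Psi -> sound Phi Psi -> UInf Psi A ->
  ctsmor Phi (HomU Psi A) I f -> 0 <= s < t -> t <= 1 ->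
  exists b : A, forall p, (t <= val (f p) -> val (ev b p) = 1) /\
                          (0 < val (ev b p) -> s <= val (f p)).
Proof.
  intros hPhi hPsi hs hA hf hst ht.
  pose proof (HomU_complete Psi A) as hX.
  destruct (level_min_ex _ f t hX (proj1 hf)) as [y hy]; [lra|].
  destruct (level_min_ex _ f s hX (proj1 hf)) as [x hx]; [lra|].
  assert (hxy : way_below Phi (HomU Psi A) x y).
  { apply (way_below_level Phi _ f s); auto; [|intros z hz; apply hx, hz].
    assert (t <= val (f y)) by apply hy, ple_refl; lra. }
  destruct (hxy (approximants ev y)) as [a [ha hax]].
  - apply (approximants_PhiL Phi Psi); auto.
    + intros a S m; apply ev_glb.
    + intros a b q h; apply ev_mono, h.
  - intros j hj a; apply Ile.
    apply (approximants_lub_ge Psi A (HomU Psi A) ev y j a); auto.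
    + intros b S m; apply ev_glb.
    + intros u b q; apply ev_act.
  - exists (act (ramp (1 / 2) 1) a); intros p; rewrite ev_act; split.
    + intros hp; apply hy in hp; apply ramp_hi; try lra.
      rewrite <- ha; apply val_le, (hp a).
    + intros hp; apply ramp_gt0 in hp; try lra; apply hx, hax; lra.
Qed.

Lemma ramp0_val (c : R) (y : I) : 0 < c <= 1 ->
  val (app (ramp 0 c) y) * c = Rmin c (val y).
Proof.
  intros hc; pose proof (val_bounds y); destruct (Rle_dec c (val y)).
  - rewrite ramp_hi by lra; rewrite Rmin_left; lra.
  - rewrite ramp_mid by lra; rewrite Rmin_right by lra; field; lra.
Qed.

Lemma ramp_pos (c : R) (y : I) : 0 <= c < 1 -> c < val y ->
  0 < val (app (ramp c 1) y).
Proof.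
  intros hc hy; pose proof (val_bounds y); rewrite ramp_mid by lra.
  apply Rdiv_lt_0_compat; lra.
Qed.

(** Up to one step, [p c] times [m + 1] counts the levels [1/N, ..., (m+1)/N] reached by [f p]. Each
    induction step stacks the separator for the next level on top. *)
Lemma stacking (Phi Psi : Doctrine) (A : UPoset) (f : HomU Psi A -> I) (N m : nat) :
  join_doctrine Phi -> join_doctrine Psi -> sound Phi Psi -> Phi natP ->
  UInf Psi A -> archimedean A -> stackable A -> ctsmor Phi (HomU Psi A) I f ->
  (S m <= N)%nat ->
  exists c : A, forall p k, (k <= m)%nat ->
    (INR (S k) <= val (f p) * INR N -> INR (S k) <= val (ev c p) * INR (S m)) /\
    (INR k < val (ev c p) * INR (S m) -> INR k <= val (f p) * INR N).
Proof.
  intros hPhi hPsi hs hnat hA harch [hun hst] hf.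
  induction m as [|m IH]; intros hm.
  - assert (hN : 1 <= INR N) by (apply (le_INR 1); lia).
    destruct (separator Phi Psi A f 0 (/ INR N)) as [b hb]; auto.
    { split; [lra|apply Rinv_0_lt_compat; lra]. }
    { rewrite <- Rinv_1; apply Rinv_le_contravar; lra. }
    exists b; intros p k hk; replace k with O by lia; simpl; split.
    + intros h; rewrite (proj1 (hb p)); [lra|].
      apply (Rmult_le_reg_r (INR N)); [lra|]; rewrite Rinv_l; lra.
    + intros _; pose proof (val_bounds (f p)); nra.
  - destruct IH as [c hc]; [lia|].
    pose proof (pos_INR m) as hm0.
    assert (hN : INR m + 2 <= INR N)
      by (apply le_INR in hm; rewrite !S_INR in hm; lra).
    rewrite !S_INR in hc; rewrite !S_INR.
    set (M := INR m) in *; set (L := INR N) in *.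
    assert (hL : L * / L = 1) by (apply Rinv_r; lra).
    assert (hLx : forall x, x * / L * L = x) by (intros x; field; lra).
    assert (hL0 : 0 < / L) by (apply Rinv_0_lt_compat; lra).
    destruct (separator Phi Psi A f ((M + 1) * / L) ((M + 2) * / L)) as [b hb];
      auto; [nra|nra|].
    (* The old element fills [m + 1] of the [m + 2] equal slots. *)
    set (r := (M + 1) / (M + 1 + 1)).
    assert (hr : r * (M + 1 + 1) = M + 1) by (unfold r; field; lra).
    assert (hr01 : 0 < r < 1) by nra.
    destruct (hst r (ramp 0 r) (ramp r 1) hr01 (ramp_iso_lo r hr01)
                (ramp_iso_hi r hr01) c b) as [d [hd1 hd2]].
    (* Tested on each [p]: if the separator is positive there, all lower levels have been reached,
       so [c] has value 1. *)
    { intros u v; apply (HomU_order Phi Psi); auto; intros p; rewrite !ev_act.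
      pose proof (val_bounds (ev b p)).
      destruct (Rle_dec (val (ev b p)) 0).
      - rewrite (app0 v) by lra; apply val_bounds.
      - assert (hfp := proj2 (hb p) ltac:(lra)).
        assert (hcp : M + 1 <= val (ev c p) * (M + 1)).
        { replace (M + 1) with (INR (S m)) at 1 by apply S_INR.
          apply (hc p m (le_n m)); rewrite S_INR; fold M.
          apply (Rmult_le_compat_r L) in hfp; [|lra].
          rewrite hLx in hfp; exact hfp. }
        rewrite (app1 u); [apply val_bounds|].
        pose proof (val_bounds (ev c p)); nra. }
    exists d; intros p k hk.
    assert (e1 : val (app (ramp 0 r) (ev d p)) = val (ev c p))
      by (rewrite <- hd1, ev_act; reflexivity).
    assert (e2 : val (app (ramp r 1) (ev d p)) = val (ev b p))
      by (rewrite <- hd2, ev_act; reflexivity).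
    pose proof (ramp0_val r (ev d p) ltac:(lra)) as e3; rewrite e1 in e3.
    pose proof (val_bounds (ev d p)) as hdb.
    destruct (Nat.eq_dec k (S m)) as [->|hne].
    + rewrite !S_INR; fold M; split.
      * intros h.
        assert (hbp : val (ev b p) = 1).
        { apply hb; apply (Rmult_le_reg_r L); [lra|]; rewrite hLx; lra. }
        rewrite hbp in e2; apply ramp_eq1 in e2; nra.
      * intros h.
        assert (hrd : r < val (ev d p)) by nra.
        pose proof (ramp_pos r (ev d p) ltac:(lra) hrd) as hp; rewrite e2 in hp.
        apply hb in hp; apply (Rmult_le_compat_r L) in hp; [|lra].
        rewrite hLx in hp; exact hp.
    + destruct (hc p k ltac:(lia)) as [h1 h2]; rewrite S_INR in h1.
      assert (hkm : INR k <= M) by (apply le_INR; lia).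
      split.
      * rewrite S_INR; intros h; apply h1 in h.
        assert (Rmin r (val (ev d p)) <= val (ev d p)) by apply Rmin_r.
        nra.
      * intros h; apply h2.
        apply Rmult_lt_reg_r with r; [lra|].
        unfold Rmin in e3; destruct Rle_dec; nra.
Qed.

Lemma nat_floor (x : R) : 0 <= x -> exists j, INR j <= x < INR j + 1.
Proof.
  intros hx; destruct (archimed x) as [h1 h2].
  assert (hz : (0 < Rdefinitions.up x)%Z) by (apply lt_IZR; lra).
  destruct (IZN (Rdefinitions.up x - 1)) as [j hj]; [lia|].
  exists j; rewrite INR_IZR_INZ, <- hj, minus_IZR; lra.
Qed.

(** With all [n + 1] levels stacked, the values of [c] and [f] differ by at most one grid step. *)
Lemma approximation (Phi Psi : Doctrine) (A : UPoset) (f : HomU Psi A -> I) (n : nat) :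
  join_doctrine Phi -> join_doctrine Psi -> sound Phi Psi -> Phi natP ->
  UInf Psi A -> archimedean A -> stackable A -> ctsmor Phi (HomU Psi A) I f ->
  exists c : A, forall p, Rabs (val (ev c p) - val (f p)) <= / (INR n + 1).
Proof.
  intros hPhi hPsi hs hnat hA harch hst hf.
  destruct (stacking Phi Psi A f (S n) n) as [c hc]; auto.
  exists c; intros p; rewrite S_INR in hc.
  pose proof (pos_INR n) as hn; pose proof (val_bounds (f p)) as hfp.
  pose proof (val_bounds (ev c p)) as hcp.
  assert (hL : (INR n + 1) * / (INR n + 1) = 1) by (apply Rinv_r; lra).
  destruct (nat_floor (val (f p) * (INR n + 1))) as [j hj]; [nra|].
  assert (hjn : INR j <= INR n + 1) by nra.
  assert (hLp : 0 < INR n + 1) by lra.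
  set (L := INR n + 1) in *.
  assert (h1 : val (f p) * L - 1 <= val (ev c p) * L).
  { destruct j as [|j]; [simpl in hj; nra|].
    assert (hjn' : (j <= n)%nat).
    { apply INR_le; rewrite S_INR in hjn; unfold L in hjn; lra. }
    destruct (hc p j hjn') as [h _]; specialize (h (proj1 hj)); lra. }
  assert (h2 : val (ev c p) * L <= val (f p) * L + 1).
  { apply Rnot_lt_le; intros hlt.
    assert (hjn' : (S j <= n)%nat).
    { apply Nat.lt_succ_r, INR_lt; rewrite !S_INR; fold L; nra. }
    destruct (hc p (S j) hjn') as [_ h]; rewrite S_INR in h.
    specialize (h ltac:(lra)); lra. }
  apply Rabs_le; split; apply (Rmult_le_reg_r L); nra.
Qed.

(** * The duality *)

Lemma HomC_HomU_point (Phi Psi : Doctrine) (A : UPoset) (f : HomC Phi (HomU Psi A)) :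
  join_doctrine Phi -> join_doctrine Psi -> sound Phi Psi -> Phi natP ->
  UInf Psi A -> completeU A -> stackable A ->
  exists a : A, forall p, ev a p = evC p f.
Proof.
  intros hPhi hPsi hs hnat hA [harch hcomp] hst.
  assert (hE := HomU_separating Phi Psi A hPhi hPsi hs hnat hA harch (proj1 hst)).
  assert (hc : forall n, exists c : A, forall p,
             Rabs (val (ev c p) - val (evC p f)) <= / (INR n + 1)).
  { intros n; apply (approximation Phi Psi A (fun p => evC p f) n); auto.
    apply evC_ctsmor. }
  pose (c := fun n => proj1_sig (constructive_indefinite_description _ (hc n))).
  assert (hc' : forall n p, Rabs (val (ev (c n) p) - val (evC p f)) <= / (INR n + 1)).
  { intros n; exact (proj2_sig (constructive_indefinite_description _ (hc n))). }
  destruct (hcomp c) as [a ha].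
  - intros e he; destruct (inv_succ_small (e / 3)) as [N hN]; [lra|].
    exists N; intros n m hn hm.
    (* Thirds rather than halves, since a uniform bound on the differences only bounds [rho] weakly
       and [dist_lt] is strict. *)
    apply (dist_lt_intro A _ _ _ _ (2 * (e / 3)) e hE); [lra|].
    intros p; pose proof (Rabs_le_inv _ _ (hc' n p)).
    pose proof (Rabs_le_inv _ _ (hc' m p)).
    apply inv_succ_anti in hn; apply inv_succ_anti in hm.
    apply Rabs_le; lra.
  - exists a; intros p; apply val_inj, cond_eq; intros e he.
    destruct (ha (e / 2)) as [N hN]; [lra|].
    destruct (inv_succ_small (e / 2)) as [M hM]; [lra|].
    specialize (hN (max N M) ltac:(lia)).
    pose proof (dist_lt_elim A _ _ _ _ _ hE hN p) as h1; simpl in h1.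
    apply Rabs_def2 in h1; pose proof (Rabs_le_inv _ _ (hc' (max N M) p)).
    assert (h2 : / (INR (max N M) + 1) <= / (INR M + 1))
      by (apply inv_succ_anti; lia).
    apply Rabs_def1; lra.
Qed.

Definition unit_map (Phi Psi : Doctrine) (hPhi : join_doctrine Phi)
  (hPsi : join_doctrine Psi) (hs : sound Phi Psi) (X : Poset) (x : X)
  : HomU Psi (HomC Phi X) :=
  exist _ (evC x) (evC_umor Phi Psi X x hPhi hPsi hs).

Definition counit_map (Phi Psi : Doctrine) (hPhi : join_doctrine Phi)
  (hPsi : join_doctrine Psi) (hs : sound Phi Psi) (A : UPoset) (a : A)
  : HomC Phi (HomU Psi A) :=
  exist _ (ev a) (ev_ctsmor Phi Psi A a hPhi hPsi hs).

(** An order isomorphism preserves all existing meets and joins, so order reflection and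
    surjectivity suffice. *)
Lemma unit_map_iso (Phi Psi : Doctrine) (hPhi : join_doctrine Phi)
  (hPsi : join_doctrine Psi) (hs : sound Phi Psi) (X : Poset) :
  cts_lattice Phi X ->
  ctsmor Phi X (HomU Psi (HomC Phi X)) (unit_map Phi Psi hPhi hPsi hs X) /\
  exists inv : HomU Psi (HomC Phi X) -> X,
    ctsmor Phi (HomU Psi (HomC Phi X)) X inv /\
    (forall x, inv (unit_map Phi Psi hPhi hPsi hs X x) = x) /\
    (forall z, unit_map Phi Psi hPhi hPsi hs X (inv z) = z).
Proof.
  intros hX; set (eta := unit_map Phi Psi hPhi hPsi hs X).
  assert (hord : forall x y, ple x y <-> ple (eta x) (eta y)).
  { intros x y; split.
    - intros h f; apply Ile, evC_mono, h.
    - intros h; apply (HomC_order Phi); auto; intros f; apply val_le, (h f). }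
  assert (hsur : forall p, exists x, eta x = p).
  { intros p; destruct (HomU_HomC_point Phi Psi X p) as [x hx]; auto.
    exists x; apply HomU_ext; exact hx. }
  pose (inv := fun p => proj1_sig (constructive_indefinite_description _ (hsur p))).
  assert (hinv : forall p, eta (inv p) = p).
  { intros p; exact (proj2_sig (constructive_indefinite_description _ (hsur p))). }
  assert (hinv' : forall x, inv (eta x) = x).
  { intros x; apply ple_anti; apply hord; rewrite hinv; apply ple_refl. }
  split; [apply (order_iso_ctsmor Phi _ _ eta inv); auto|].
  exists inv; split; auto; apply (order_iso_ctsmor Phi _ _ inv eta); auto.
  intros p q; rewrite hord, !hinv; reflexivity.
Qed.

Lemma order_iso_umor (Psi : Doctrine) (A B : UPoset) (h : A -> B) (g : B -> A) :
  (forall a a', ple a a' <-> ple (h a) (h a')) -> (forall b, h (g b) = b) ->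
  (forall u a, h (act u a) = act u (h a)) -> umor Psi A B h.
Proof.
  intros hh hg hact; split; [intros a a'; apply hh|split; [exact hact|]].
  intros S m _; apply (order_iso_glb A B h g); auto.
Qed.

Lemma counit_map_iso (Phi Psi : Doctrine) (hPhi : join_doctrine Phi)
  (hPsi : join_doctrine Psi) (hs : sound Phi Psi) (A : UPoset) :
  Phi natP -> UInf Psi A -> completeU A -> stackable A ->
  umor Psi A (HomC Phi (HomU Psi A)) (counit_map Phi Psi hPhi hPsi hs A) /\
  exists inv : HomC Phi (HomU Psi A) -> A,
    umor Psi (HomC Phi (HomU Psi A)) A inv /\
    (forall a, inv (counit_map Phi Psi hPhi hPsi hs A a) = a) /\
    (forall z, counit_map Phi Psi hPhi hPsi hs A (inv z) = z).
Proof.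
  intros hnat hA hcomp hst; set (eps := counit_map Phi Psi hPhi hPsi hs A).
  assert (hord : forall a b, ple a b <-> ple (eps a) (eps b)).
  { intros a b; split.
    - intros h p; apply Ile, ev_mono, h.
    - intros h.
      apply (HomU_order Phi Psi A a b hPhi hPsi hs hnat hA (proj1 hcomp) (proj1 hst)).
      intros p; apply val_le, (h p). }
  assert (hsur : forall f, exists a, eps a = f).
  { intros f; destruct (HomC_HomU_point Phi Psi A f) as [a ha]; auto.
    exists a; apply HomC_ext; exact ha. }
  pose (inv := fun f => proj1_sig (constructive_indefinite_description _ (hsur f))).
  assert (hinv : forall f, eps (inv f) = f).
  { intros f; exact (proj2_sig (constructive_indefinite_description _ (hsur f))). }
  assert (hinv' : forall a, inv (eps a) = a).
  { intros a; apply ple_anti; apply hord; rewrite hinv; apply ple_refl. }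
  assert (hact : forall u a, eps (act u a) = act u (eps a)).
  { intros u a; apply HomC_ext; intros p; apply (ev_act p u a). }
  split; [apply (order_iso_umor Psi _ _ eps inv); auto|].
  exists inv; split; auto; apply (order_iso_umor Psi _ _ inv eps); auto.
  - intros f g; rewrite hord, !hinv; reflexivity.
  - intros u f; rewrite <- (hinv f) at 1; rewrite <- hact; apply hinv'.
Qed.

Lemma ctsmor_comp (Phi : Doctrine) (X Y Z : Poset) (h : X -> Y) (g : Y -> Z) :
  join_doctrine Phi -> ctsmor Phi X Y h -> ctsmor Phi Y Z g ->
  ctsmor Phi X Z (fun x => g (h x)).
Proof.
  intros hPhi hh hg.
  assert (e : forall (S : X -> Prop) z,
             image g (image h S) z <-> image (fun x => g (h x)) S z).
  { intros S z; split.
    - intros [y [[x [hx <-]] <-]]; exists x; auto.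
    - intros [x [hx <-]]; exists (h x); split; auto; exists x; auto. }
  split.
  - intros S m hm; apply (is_glb_ext _ _ _ (e S)); apply hg, hh, hm.
  - intros S m hS hm; apply (is_lub_ext _ _ _ (e S)); apply hg; [|apply hh; auto].
    apply (doctrine_sub Phi (sub X S) Y (fun x => h (proj1_sig x))); auto.
    + intros x y hxy; apply (mono_of_glb h (proj1 hh)); exact hxy.
    + intros [x hx]; exists x; auto.
    + intros y [x [hx <-]]; exists (exist _ x hx); apply ple_refl.
Qed.

Lemma umor_comp (Psi : Doctrine) (A B C : UPoset) (k : A -> B) (g : B -> C) :
  join_doctrine Psi -> umor Psi A B k -> umor Psi B C g ->
  umor Psi A C (fun a => g (k a)).
Proof.
  intros hPsi (k1 & k2 & k3) (g1 & g2 & g3); split; [|split].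
  - intros a b h; apply g1, k1, h.
  - intros u a; rewrite k2, g2; reflexivity.
  - intros S m hS hm.
    apply (is_glb_ext (image g (image k S))).
    { intros z; split.
      - intros [y [[x [hx <-]] <-]]; exists x; auto.
      - intros [x [hx <-]]; exists (k x); split; auto; exists x; auto. }
    apply g3; [|apply k3; auto].
    assert (inc : forall x : op (sub A S), image k S (k (proj1_sig x))).
    { intros [x hx]; exists x; auto. }
    pose proof hPsi as (_ & _ & h3 & _).
    apply (h3 (op (sub A S)) (op (sub B (image k S)))
             (fun x => exist _ (k (proj1_sig x)) (inc x))); auto.
    + intros x y h; apply k1; exact h.
    + intros [y [x [hx <-]]].
      exists (exist _ (k x) (inc (exist _ x hx))); split.
      * exists (exist _ x hx); split; auto; exact Logic.I.
      * apply (ple_refl B).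
Qed.

Theorem theorem5p3 (Phi Psi : Doctrine) :
  join_doctrine Phi -> join_doctrine Psi -> Phi natP -> sound Phi Psi ->
  (* the object parts of the two functors are well defined *)
  (forall X : Poset, cts_lattice Phi X ->
     UInf Psi (HomC Phi X) /\ completeU (HomC Phi X) /\ stackable (HomC Phi X)) /\
  (forall A : UPoset, UInf Psi A -> completeU A -> stackable A ->
     cts_lattice Phi (HomU Psi A)) /\
  (* the morphism parts (precomposition) are well defined *)
  (forall (X Y : Poset) (h : X -> Y),
     cts_lattice Phi X -> cts_lattice Phi Y -> ctsmor Phi X Y h ->
     exists Fh : HomC Phi Y -> HomC Phi X,
       (forall (g : HomC Phi Y) (x : X), proj1_sig (Fh g) x = proj1_sig g (h x)) /\
       umor Psi (HomC Phi Y) (HomC Phi X) Fh) /\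
  (forall (A B : UPoset) (k : A -> B),
     UInf Psi A -> completeU A -> stackable A ->
     UInf Psi B -> completeU B -> stackable B -> umor Psi A B k ->
     exists Gk : HomU Psi B -> HomU Psi A,
       (forall (g : HomU Psi B) (a : A), proj1_sig (Gk g) a = proj1_sig g (k a)) /\
       ctsmor Phi (HomU Psi B) (HomU Psi A) Gk) /\
  (* unit: natural isomorphism Id ~= G o F on PhiCtsLat *)
  (exists eta : forall X : Poset, X -> HomU Psi (HomC Phi X),
     (forall X : Poset, cts_lattice Phi X ->
        ctsmor Phi X (HomU Psi (HomC Phi X)) (eta X) /\
        exists inv : HomU Psi (HomC Phi X) -> X,
          ctsmor Phi (HomU Psi (HomC Phi X)) X inv /\
          (forall x, inv (eta X x) = x) /\ (forall z, eta X (inv z) = z)) /\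
     (forall (X Y : Poset) (h : X -> Y),
        cts_lattice Phi X -> cts_lattice Phi Y -> ctsmor Phi X Y h ->
        forall (x : X) (g : HomC Phi Y) (g' : HomC Phi X),
          (forall z, proj1_sig g' z = proj1_sig g (h z)) ->
          proj1_sig (eta Y (h x)) g = proj1_sig (eta X x) g')) /\
  (* counit: natural isomorphism Id ~= F o G on complete stackable inflattices *)
  (exists eps : forall A : UPoset, A -> HomC Phi (HomU Psi A),
     (forall A : UPoset, UInf Psi A -> completeU A -> stackable A ->
        umor Psi A (HomC Phi (HomU Psi A)) (eps A) /\
        exists inv : HomC Phi (HomU Psi A) -> A,
          umor Psi (HomC Phi (HomU Psi A)) A inv /\
          (forall a, inv (eps A a) = a) /\ (forall z, eps A (inv z) = z)) /\
     (forall (A B : UPoset) (k : A -> B),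
        UInf Psi A -> completeU A -> stackable A ->
        UInf Psi B -> completeU B -> stackable B -> umor Psi A B k ->
        forall (a : A) (g : HomU Psi B) (g' : HomU Psi A),
          (forall z, proj1_sig g' z = proj1_sig g (k z)) ->
          proj1_sig (eps B (k a)) g = proj1_sig (eps A a) g')).
Proof.
  intros hPhi hPsi hnat hs; split; [|split; [|split; [|split; [|split]]]].
  - intros X hX; split; [|split].
    + apply HomC_UInf; auto.
    + apply HomC_completeU.
    + apply HomC_stackable.
  - intros A hA _ _; apply HomU_cts; auto.
  - intros X Y h _ _ hh.
    exists (fun g => exist _ (fun x => evC (h x) g)
                       (ctsmor_comp Phi X Y I h _ hPhi hh (evC_ctsmor g))).
    split; [reflexivity|split; [|split]].
    + intros f g hfg x; exact (hfg (h x)).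
    + intros u g; apply HomC_ext; reflexivity.
    (* Meets of [Psi]-type in [HomC] are computed pointwise, hence kept by precomposition. *)
    + intros S m hS hm; split.
      * intros y [f [hf <-]] x; exact (proj1 hm f hf (h x)).
      * intros z hz x; apply (evC_glb Phi Psi Y S m (h x)); auto.
        intros y [f [hf <-]].
        exact (hz _ (ex_intro _ f (conj hf eq_refl)) x).
  - intros A B k _ _ _ _ _ _ hk.
    exists (fun p => exist _ (fun a => ev (k a) p)
                       (umor_comp Psi A B IU k _ hPsi hk (ev_umor p))).
    split; [reflexivity|split].
    + intros S m hm; split.
      * intros y [p [hp <-]] a; exact (proj1 hm p hp (k a)).
      * intros z hz a; apply (ev_glb S m (k a)); auto.
        intros y [p [hp <-]].
        exact (hz _ (ex_intro _ p (conj hp eq_refl)) a).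
    + intros S m hS hm; split.
      * intros y [p [hp <-]] a; exact (proj1 hm p hp (k a)).
      * intros z hz a; apply (ev_lub Phi S m (k a)); auto.
        intros y [p [hp <-]].
        exact (hz _ (ex_intro _ p (conj hp eq_refl)) a).
  - exists (unit_map Phi Psi hPhi hPsi hs); split.
    + intros X hX; apply unit_map_iso; auto.
    + intros X Y h _ _ _ x g g' hg; symmetry; exact (hg x).
  - exists (counit_map Phi Psi hPhi hPsi hs); split.
    + intros A hA hc hst; apply counit_map_iso; auto.
    + intros A B k _ _ _ _ _ _ _ a g g' hg; symmetry; exact (hg a).
Qed.
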